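(* All the choices of $p_r$, $p_{ra}$, $p$, $p_a$, $i$ and $i_a$ together generate four types of Jones polynomials for long virtual knots: among the maps $p_r$, $p_{ra}$, $i\circ p$, $i\circ p_a$, $i_a\circ p$, $i_a\circ p_a$ from based Gauss diagrams to sign-labelled chord diagrams there are exactly four different ones, $p_r$, $p_{ra}$, $i\circ p=i_a\circ p_a$ and $i_a\circ p=i\circ p_a$, and the corresponding four polynomials $V_{p_r(D)}$, $V_{p_{ra}(D)}$, $V_{i\circ p(D)}$, $V_{i_a\circ p(D)}$ of a diagram $D$ are invariants of the long virtual knot represented by $D$. Moreover, the tuple of these four versions of the Jones polynomial is a stronger invariant of long virtual knots than the Jones polynomial: there exist long virtual knots $K_1,K_2$ with $V_{K_1}=V_{K_2}$ whose tuples of four polynomials are different.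
   Context: All knots are oriented. A long virtual knot diagram is a generic immersion of the oriented line in the plane (standard outside a compact set; equivalently an oriented circle with a base point away from the double points), with finitely many transversal double points, each declared either a real crossing (with over/under information) or a virtual crossing. A long virtual knot is a class of such diagrams modulo planar isotopy, Reidemeister moves and virtual moves performed away from the base point. Closing the line (forgetting the base point) gives a virtual knot. The Gauss diagram of a (long) virtual knot diagram is the counterclockwise oriented circle (with base point in the long case) with one chord joining the two preimages of each real crossing; each chord carries the sign (local writhe) of the crossing and an arrow from the over-branch to the under-branch; virtual crossings are ignored. Gauss diagrams are considered up to orientation (and base point) preserving homeomorphism. A Gauss diagram determines a virtual diagram up to virtual moves, and long virtual knots are the same as based Gauss diagrams modulo the Gauss-diagram versions of the Reidemeister moves performed away from the base point. A diagram is identified with its based Gauss diagram. Map $p_r$: forgets the arrows of a Gauss diagram and keeps the signs of chords. Map $p_{ra}=\tau_1\circ p_r$, where $\tau_1$ exchanges $+$ and $-$ on all chords. Map $p$: for a based Gauss diagram $G$, call the first endpoint of a chord the endpoint met first when travelling along the oriented circle from the base point. The diagram $p(G)$ is the based circle with the same chords, with signs and arrows removed, where each chord is labelled $a$ if either (its sign is $+$ and its arrow points from the first endpoint to the second) or (its sign is $-$ and its arrow points from the second endpoint to the first), and is labelled $b$ otherwise. Map $p_a=\tau_0\circ p$, where $\tau_0$ exchanges $a$ and $b$ on all chords. Map $i$: for a based chord diagram with chords labelled $a$ or $b$, $i$ replaces each label $a$ by the sign $+$ and each label $b$ by the sign $-$, giving a based chord diagram whose chords carry signs but no arrows. Map $i_a=\tau_1\circ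 i$. Jones polynomial: for a virtual knot diagram $D$ with writhe $w(D)$ (number of positive minus number of negative real crossings), $$V_D(t)=(-A^3)^{-w(D)}\sum_{s}A^{\sigma(s)}(-A^2-A^{-2})^{|s|-1}\Big|_{A=t^{-1/4}},$$ where $s$ runs over states, i.e. assignments of a positive or negative marker to every real crossing ($\sigma(s)$ = number of positive minus number of negative markers) and $|s|$ is the number of circles after smoothing the real crossings accordingly, the positive marker being the Kauffman $A$-smoothing (so the orientation-respecting smoothing is the one given by the positive marker at a positive crossing and by the negative marker at a negative crossing). For a long virtual knot $K$, $V_K$ is the Jones polynomial of the virtual knot obtained by forgetting the base point. For a chord diagram $P$ with signs on chords but no arrows, $V_P$ denotes $V_G$ for any Gauss diagram $G$ obtained from $P$ by choosing arrows (and forgetting any base point); by a theorem of Turaev this does not depend on the choice of arrows. *)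

(* Defs.v *)
From HB Require Import structures.
From mathcomp Require Import all_boot all_order all_algebra.
From mathcomp Require Import fraction.

Set Implicit Arguments.
Unset Strict Implicit.
Unset Printing Implicit Defensive.

Import GRing.Theory.

Variant sign := Plus | Minus.

Definition bool_of_sign e := if e is Plus then true else false.
Definition sign_of_bool (b : bool) := if b then Plus else Minus.
Lemma bool_of_signK : cancel bool_of_sign sign_of_bool. Proof. by case. Qed.
HB.instance Definition _ := Countable.copy sign (can_type bool_of_signK).
HB.instance Definition _ : isFinite sign := CanIsFinite bool_of_signK.

Definition signz (e : sign) : int := if e is Plus then 1%R else (-1)%R.
Definition tau1 (e : sign) : sign := if e is Plus then Minus else Plus.

Variant ablabel := La | Lb.

Definition tau0 (x : ablabel) : ablabel := if x is La then Lb else La.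

(* A based circle with chords is cut open at the base point and read as the
   word of chord endpoints met along the orientation, chords being named by
   natural numbers.  In a based Gauss diagram an endpoint is a pair (c, o),
   where o tells whether c is passed over (the tail of its arrow) or under
   (the head of its arrow).  The values of gsign and clab at names that do not
   occur in the word are irrelevant.                                         *)
Definition gauss_wf (w : seq (nat * bool)) : bool :=
  uniq w && all (fun x => (x.1, ~~ x.2) \in w) w.

Record gauss := Gauss {
  gword : seq (nat * bool);
  gsign : nat -> sign;
  gwordP : gauss_wf gword
}.

Definition gchords (G : gauss) : seq nat := map fst (gword G).

Definition chord_wf (w : seq nat) : bool := all (fun c => count_mem c w == 2) w.

Record cdiag (L : Type) := CDiag {
  cword : seq nat;
  clab : nat -> L;
  cwordP : chord_wf cword
}.

(* Orientation and base point preserving homeomorphism: renaming of chords.  *)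
Definition gauss_iso (G H : gauss) : Prop :=
  exists f : nat -> nat,
    [/\ {in gchords G &, injective f},
        gword H = [seq (f x.1, x.2) | x <- gword G] &
        {in gchords G, forall c, gsign H (f c) = gsign G c}].

Definition cdiag_iso (L : Type) (P Q : cdiag L) : Prop :=
  exists f : nat -> nat,
    [/\ {in cword P &, injective f},
        cword Q = map f (cword P) &
        {in cword P, forall c, clab Q (f c) = clab P c}].

(* Gauss-diagram Reidemeister moves away from the base point, on words, for a
   fixed assignment sg of signs to names.
   In R3 the crossings are x (top over middle), y (top over bottom) and
   z (middle over bottom); t, m, b tell which of the two crossings on the top,
   middle and bottom strands comes first.  For three oriented lines in the
   plane with directions u_T, u_M, u_B the sides of the triangle x y z satisfy
     (y - x) + (z - y) = z - x,   y - x = alpha u_T,   z - y = gamma u_B,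
     z - x = beta u_M,
   where alpha, beta, gamma have the signs t, m, b, and a crossing has the
   sign of det (u_over, u_under); so t sg(z) = m sg(y) = b sg(x).  The three
   strands may occur in any order along the line.                            *)
Definition strand (T : Type) (o : bool) (u v : T) : seq T :=
  if o then [:: u; v] else [:: v; u].

Definition same (o : bool) (e : sign) : bool := o == (e == Plus).

Inductive rmove (sg : nat -> sign) :
    seq (nat * bool) -> seq (nat * bool) -> Prop :=
| R1 (w0 w1 : seq (nat * bool)) (x : nat) (o : bool) :
    rmove sg (w0 ++ w1) (w0 ++ [:: (x, o); (x, ~~ o)] ++ w1)
| R2 (w0 w1 w2 : seq (nat * bool)) (x y : nat) (o d : bool) :
    sg x != sg y ->
    rmove sg (w0 ++ w1 ++ w2)
      (w0 ++ [:: (x, o); (y, o)] ++ w1 ++ strand d (x, ~~ o) (y, ~~ o) ++ w2)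
| R3 (w0 w1 w2 w3 s1 s2 s3 : seq (nat * bool)) (x y z : nat) (t m b : bool) :
    same t (sg z) = same m (sg y) -> same m (sg y) = same b (sg x) ->
    perm_eq [:: s1; s2; s3]
      [:: strand t (x, true) (y, true);
          strand m (x, false) (z, true);
          strand b (y, false) (z, false)] ->
    rmove sg (w0 ++ s1 ++ w1 ++ s2 ++ w2 ++ s3 ++ w3)
      (w0 ++ rev s1 ++ w1 ++ rev s2 ++ w2 ++ rev s3 ++ w3).

(* Two based Gauss diagrams represent the same long virtual knot.            *)
Inductive lvk_equiv : gauss -> gauss -> Prop :=
| lvk_iso G H : gauss_iso G H -> lvk_equiv G H
| lvk_move G H : gsign G =1 gsign H -> rmove (gsign G) (gword G) (gword H) ->
    lvk_equiv G H
| lvk_sym G H : lvk_equiv G H -> lvk_equiv H G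
| lvk_trans G H K : lvk_equiv G H -> lvk_equiv H K -> lvk_equiv G K.

Definition long_invariant (T : Type) (F : gauss -> T) : Prop :=
  forall D D' : gauss, lvk_equiv D D' -> F D = F D'.

Lemma gchords_wf (G : gauss) : chord_wf (gchords G).
Proof.
rewrite /chord_wf /gchords; case: G => w sg /= /andP[Uw /allP Pw].
apply/allP => _ /mapP[[c o] cw ->] /=; rewrite count_map.
have -> : count (preim fst (pred1 c)) w =
    (count_mem (c, true) w + count_mem (c, false) w).
  elim: w {Uw Pw cw} => //= -[d u] w ->; rewrite !xpair_eqE.
  by case: u; case: (d == c); rewrite //= ?addnS ?addSn.
rewrite !count_uniq_mem //; have := Pw _ cw; move: cw => /=.
by case: o => /= -> ->.
Qed.

Definition relabel (L M : Type) (h : L -> M) (P : cdiag L) : cdiag M :=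
  CDiag (h \o clab P) (cwordP P).

Definition map_pr (G : gauss) : cdiag sign := CDiag (gsign G) (gchords_wf G).

Definition map_pra (G : gauss) : cdiag sign := relabel tau1 (map_pr G).

(* The arrow of c points from its first to its second endpoint.              *)
Definition arrow_forward (G : gauss) (c : nat) : bool :=
  (index (c, true) (gword G) < index (c, false) (gword G)).

Definition ab_of (e : sign) (forward : bool) : ablabel :=
  match e, forward with
  | Plus, true | Minus, false => La
  | _, _ => Lb
  end.

Definition map_p (G : gauss) : cdiag ablabel :=
  CDiag (fun c => ab_of (gsign G c) (arrow_forward G c)) (gchords_wf G).

Definition map_pa (G : gauss) : cdiag ablabel := relabel tau0 (map_p G).

Definition map_i (P : cdiag ablabel) : cdiag sign :=
  relabel (fun x => if x is La then Plus else Minus) P.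

Definition map_ia (P : cdiag ablabel) : cdiag sign := relabel tau1 (map_i P).

Definition same_map (F H : gauss -> cdiag sign) : Prop :=
  forall G : gauss, cdiag_iso (F G) (H G).

(* The base point and the m = size w endpoints cut the line into m.+1 arcs:
   the arc k enters the endpoint number k and the arc k.+1 leaves it.  Closing
   the line joins the arcs 0 and m.  Smoothing the chord with endpoints k, l
   joins the arc entering each endpoint with the arc leaving the other one if
   the smoothing respects the orientation, and otherwise the two entering arcs
   and the two leaving arcs.                                                 *)
Definition joined (w : seq nat) (oriented : nat -> bool) :
    rel 'I_(size w).+1 := fun u v =>
  [|| (u == 0 :> nat) && (v == size w :> nat),
      (v == 0 :> nat) && (u == size w :> nat) |
   [exists k : 'I_(size w), exists l : 'I_(size w),
     [&& k != l, nth 0 w k == nth 0 w l &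
       if oriented (nth 0 w k) then
         (u == k :> nat) && (v == l.+1 :> nat) ||
         (v == k :> nat) && (u == l.+1 :> nat)
       else
         (u == k :> nat) && (v == l :> nat) ||
         (u == k.+1 :> nat) && (v == l.+1 :> nat)]]].

Definition circles (w : seq nat) (oriented : nat -> bool) : nat :=
  n_comp (@joined w oriented) predT.

Local Open Scope ring_scope.

(* Laurent polynomials in t^(1/4) are taken in the field of fractions of
   Z[t^(1/4)]; 'X stands for t^(1/4), so that the Kauffman variable
   A = t^(-1/4) is its inverse.                                              *)
Definition qfrac := {fraction {poly int}}.

Definition kauffA : qfrac := (tofrac ('X : {poly int}))^-1.

Definition writhe (G : gauss) : int :=
  \sum_(c <- undup (gchords G)) signz (gsign G c).

(* A state lists the markers of the crossings in the order in which they are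
   listed by undup (gchords G).                                              *)
Definition marker (G : gauss) (s : seq sign) (c : nat) : sign :=
  nth Plus s (index c (undup (gchords G))).

Definition state_circles (G : gauss) (s : seq sign) : nat :=
  circles (gchords G) (fun c => marker G s c == gsign G c).

Definition jones (G : gauss) : qfrac :=
  (- kauffA ^+ 3) ^ (- writhe G) *
  \sum_(s : (size (undup (gchords G))).-tuple sign)
     kauffA ^ (\sum_(e <- s) signz e) *
     (- kauffA ^+ 2 - kauffA ^- 2) ^+ (state_circles G s).-1.

Definition forward_word (w : seq nat) : seq (nat * bool) :=
  [seq (nth 0%N w k, k == index (nth 0%N w k) w) | k <- iota 0 (size w)].

Lemma map_fst_forward_word w : map fst (forward_word w) = w.
Proof.
by rewrite /forward_word -map_comp -[RHS](mkseq_nth 0%N); apply: eq_map.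
Qed.

Lemma forward_word_wf w : chord_wf w -> gauss_wf (forward_word w).
Proof.
move=> /allP Cw; pose c k := nth 0%N w k; pose m := size w.
pose J k := [seq j <- iota 0 m | c j == c k].
have UJ k : uniq (J k) by rewrite filter_uniq ?iota_uniq.
have memJ k j : (j \in J k) = (j < m)%N && (c j == c k).
  by rewrite mem_filter mem_iota add0n andbC.
have szJ k : (k < m)%N -> size (J k) = 2%N.
  move=> km; rewrite -(eqP (Cw _ (mem_nth 0%N km))) size_filter.
  have <- : count_mem (c k) (mkseq c m) = count_mem (c k) w.
    by rewrite mkseq_nth.
  by rewrite count_map.
have idxJ k : (k < m)%N -> index (c k) w \in J k.
  by move=> km; rewrite memJ index_mem mem_nth //= /c nth_index ?mem_nth.
apply/andP; split.
  rewrite map_inj_in_uniq ?iota_uniq // => k l.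
  rewrite !mem_iota !add0n /= => km lm [ckl].
  rewrite -/(c k) -/(c l) in ckl *; rewrite -ckl.
  have [kI /esym/eqP lI|kI] := eqVneq k (index (c k) w).
    exact: etrans kI (esym lI).
  move=> /esym/negbT lI; apply/eqP; apply: contraT => nkl.
  have := @uniq_leq_size _ [:: index (c k) w; k; l] (J k).
  rewrite szJ //= !inE negb_or nkl (eq_sym _ k) kI (eq_sym _ l) lI /=.
  apply => // j; rewrite !inE => /or3P[] /eqP -> //; first exact: idxJ.
    by rewrite memJ km eqxx.
  by rewrite memJ lm ckl eqxx.
apply/allP => _ /mapP[k + ->]; rewrite mem_iota add0n /= => km.
rewrite -/(c k); have [kI|kI] := eqVneq k (index (c k) w); last first.
  apply/mapP; exists (index (c k) w); rewrite ?mem_iota ?add0n /=.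
    by rewrite index_mem mem_nth.
  by rewrite nth_index ?mem_nth // eqxx.
have /hasP[l] : has (predC1 k) (J k).
  rewrite has_predC; apply/negP => /allP Jk.
  have := @uniq_leq_size _ (J k) [:: k] (UJ k); rewrite szJ //=.
  suff sub : {subset J k <= [:: k]} by move=> /(_ sub).
  by move=> j /Jk /= /eqP ->; rewrite inE.
rewrite memJ => /andP[lm /eqP cl] /= lk.
apply/mapP; exists l; rewrite ?mem_iota //= -/(c l) cl -kI.
by rewrite (negbTE lk).
Qed.

(* Any choice of arrows gives the same polynomial: see jones_choice.         *)
Definition choose_arrows (P : cdiag sign) : gauss :=
  Gauss (clab P) (forward_word_wf (cwordP P)).

Lemma gchords_choose_arrows (P : cdiag sign) :
  gchords (choose_arrows P) = cword P.
Proof. exact: map_fst_forward_word. Qed.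

Lemma choose_arrowsK (P : cdiag sign) : map_pr (choose_arrows P) = P.
Proof.
rewrite /map_pr; move: (gchords_wf _); rewrite gchords_choose_arrows.
by case: P => w l wP wP'; rewrite (bool_irrelevance wP' wP).
Qed.

Definition jones_cd (P : cdiag sign) : qfrac := jones (choose_arrows P).

Lemma jones_choice (G : gauss) (P : cdiag sign) :
  map_pr G = P -> jones G = jones_cd P.
Proof.
move=> <-; rewrite /jones_cd /jones /writhe /state_circles /marker.
by rewrite gchords_choose_arrows.
Qed.

Definition four_jones (D : gauss) : qfrac * qfrac * qfrac * qfrac :=
  (jones_cd (map_pr D), jones_cd (map_pra D),
   jones_cd (map_i (map_p D)), jones_cd (map_ia (map_p D))).

(* Main.v *)
Require Import Defs.
From mathcomp Require Import all_boot.
From mathcomp Require Import all_order all_algebra fraction.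
From mathcomp Require Import ring zify.

Set Implicit Arguments.
Unset Strict Implicit.
Unset Printing Implicit Defensive.

Import GRing.Theory.

(* A state of the Kauffman sum is a graph on the two sides of every chord
   endpoint; its number of circles is the number of vertices minus the rank of
   the edge list.  The rank only depends on the 2-colourings of the vertices
   which are constant along the edges, so vertices of degree two can be
   contracted and auxiliary ones inserted.  Cutting the line around the strands
   of a Reidemeister move therefore reduces the invariance of the Jones
   polynomial to an identity between the state sums of two small tangles, with
   an arbitrary graph on their ends; this is a finite computation.

   The polynomial does not see the arrows, so the backward arrows can be
   reversed; the signs of i o p are the signs that a chord must then carry for
   Reidemeister moves to remain Reidemeister moves (in a third move the strands
   are put on top of each other in the order in which the line meets them).
   Exchanging all signs also preserves the moves.

   Two interlaced chords of opposite signs, one with a forward and one with a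
   backward arrow, have the Jones polynomial of the unknot by a second move,
   whereas i o p makes both signs +: this is the virtual trefoil, with
   polynomial t + t^(3/2) - t^(5/2). *)

(** * Graphs given by lists of edges *)

Section GraphRank.

Variable T : eqType.
Implicit Types (E I : seq (T * T)) (s : T -> T) (f : T -> bool).

Definition merge (a b x : T) := if x == b then a else x.

(* [rank_along s E] contracts the edges of [E] one by one; [s] sends a vertex to
   the representative of its class. *)
Fixpoint rank_along s E :=
  if E is (u, v) :: E' then
    if s u == s v then rank_along s E'
    else (rank_along (merge (s u) (s v) \o s) E').+1
  else 0.

Definition grank E := rank_along id E.

Definition verts E := flatten [seq [:: e.1; e.2] | e <- E].

Definition compat f E := all (fun e => f e.1 == f e.2) E.

Definition same_comp E E' := forall f, compat f E = compat f E'.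

Lemma verts_cons u v E : verts ((u, v) :: E) = [:: u, v & verts E].
Proof. by []. Qed.

Lemma verts_cat E E' : verts (E ++ E') = verts E ++ verts E'.
Proof. by rewrite /verts map_cat flatten_cat. Qed.

Lemma compat_cat f E E' : compat f (E ++ E') = compat f E && compat f E'.
Proof. exact: all_cat. Qed.

Lemma merge_eq a b x y :
  (merge a b x == merge a b y) =
  (x == y) || ((x == a) || (x == b)) && ((y == a) || (y == b)).
Proof.
rewrite /merge.
case: (eqVneq x b) => [->|xb]; case: (eqVneq y b) => [->|yb];
  rewrite ?eqxx ?orbT ?andbT ?orbF //=.
- by rewrite (negbTE xb).
- case: (eqVneq x y) => //= xy; case: (eqVneq x a) => [xa|] //=.
  by rewrite -xa eq_sym (negbTE xy).
Qed.

End GraphRank.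

(** The recursion only tests whether two representatives coincide, and by [merge_eq] the hypothesis
    survives each contraction. *)
Lemma rank_along_map (T U : eqType) (g : T -> U) (E : seq (T * T))
    (s : U -> U) (s' : T -> T) :
  {in verts E &, forall x y, (s (g x) == s (g y)) = (s' x == s' y)} ->
  rank_along s [seq (g e.1, g e.2) | e <- E] = rank_along s' E.
Proof.
elim: E s s' => //= -[u v] E IH s s' H /=.
have Hu : u \in verts ((u, v) :: E) by rewrite inE eqxx.
have Hv : v \in verts ((u, v) :: E) by rewrite !inE eqxx orbT.
have HE x : x \in verts E -> x \in verts ((u, v) :: E).
  by move=> xE; rewrite !inE -/(verts E) xE !orbT.
rewrite H //; case: ifP => _; first by apply: IH => x y /HE xE /HE yE; apply: H.
congr _.+1; apply: IH => x y /HE xE /HE yE /=.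
by rewrite !merge_eq !H.
Qed.

Lemma grank_map (T U : eqType) (g : T -> U) (E : seq (T * T)) :
  {in verts E &, injective g} ->
  grank [seq (g e.1, g e.2) | e <- E] = grank E.
Proof.
move=> gI; apply: rank_along_map => x y xE yE /=.
by apply/eqP/eqP => [/gI -> //|->].
Qed.

Lemma compat_map (T U : eqType) (g : T -> U) f (E : seq (T * T)) :
  compat f [seq (g e.1, g e.2) | e <- E] = compat (f \o g) E.
Proof. by rewrite /compat all_map. Qed.

Definition colourings (V : finType) (E : seq (V * V)) :=
  [set f : {ffun V -> bool} | compat f E].

(** An edge that raises the rank joins two classes and so halves the number of colourings.
    Generalising over the representative map [s] keeps the contracted graphs within the
    induction. *)
Lemma card_colourings (V : finType) (E : seq (V * V)) :
  #|colourings E| * 2 ^ grank E = 2 ^ #|V|.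
Proof.
pose m s := [seq (s e.1, s e.2) | e <- E] : seq (V * V).
suff H s : #|colourings [seq (s e.1, s e.2) | e <- E]| * 2 ^ rank_along s E
    = 2 ^ #|V|.
  by rewrite -(H id); congr (#|colourings _| * _);
     rewrite -[LHS]map_id; apply: eq_map => -[].
elim: E s {m} => [|[u v] E IH] s /=.
  rewrite muln1 -(card_bool) -card_ffun; apply: eq_card => f.
  by rewrite !inE.
case: ifPn => [/eqP suv|suv].
  rewrite -(IH s); congr (#|(_ : {set _})| * _).
  by apply/setP=> f; rewrite !inE /= suv eqxx.
rewrite -(IH (merge (s u) (s v) \o s)) expnS mulnA; congr (_ * _).
set a := s u in suv *; set b := s v in suv *.
set E1 := map _ E; set E2 := map _ E.
(* The vertex [b] no longer occurs in [E2], so changing its colour preserves [Y] and exchanges the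
   colourings with [f a = f b] and the others. Hence [Y] has twice as many elements as [X]. *)
pose tog (f : {ffun V -> bool}) := [ffun x => if x == b then ~~ f b else f x].
have togK : involutive tog.
  move=> f; apply/ffunP => x; rewrite !ffunE eqxx negbK.
  by case: eqP => [->|].
have togE2 f : compat (tog f) E2 = compat f E2.
  rewrite /compat !all_map; apply: eq_all => e /=; rewrite !ffunE /merge.
  have nab : (a == b) = false by apply: negbTE.
  by case: (s e.1 =P b) => [_|/eqP/negbTE ->];
     case: (s e.2 =P b) => [_|/eqP/negbTE ->]; rewrite ?nab.
set X := colourings _; set Y := colourings _.
pose Z := [set f : {ffun V -> bool} | f a == f b].
have XE : X = Y :&: Z.
  apply/setP=> f; rewrite !inE /= andbC; case: eqP => //= fab; rewrite ?andbF //.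
  rewrite !andbT /compat !all_map; apply: eq_all => e /=; rewrite /merge.
  by case: (s e.1 =P b) => [->|_]; case: (s e.2 =P b) => [->|_]; rewrite ?fab.
rewrite -[in RHS](cardsID Z) -XE muln2 -addnn; congr (_ + _).
rewrite -(card_imset _ (inv_inj togK)); apply: eq_card => f.
apply/idP/imsetP => [|[g]].
  rewrite XE !inE => /andP[fY /eqP fab].
  exists (tog f); last by rewrite togK.
  rewrite !inE togE2 !ffunE eqxx (negbTE suv) fab.
  by rewrite fY; case: (f b).
rewrite XE !inE => /andP[gab gY] ->; rewrite togE2 gY !ffunE eqxx.
by rewrite (negbTE suv); case: (g a) (g b) gab => [] [].
Qed.

Section GraphRankTheory.

Variable T : eqType.
Implicit Types (E I : seq (T * T)) (s : T -> T) (f : T -> bool).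

(** The rank can be read off from the number of compatible colourings, once the vertices of both
    graphs are numbered by one finite type. That number is nonzero because constant colourings are
    compatible. *)
Lemma grank_same E E' : same_comp E E' -> grank E = grank E'.
Proof.
move=> EE'; pose vs := verts (E ++ E').
pose g x : 'I_(size vs).+1 := inord (index x vs).
have gI : {in vs &, injective g}.
  move=> x y xv yv /(congr1 val) /=; rewrite !inordK ?ltnS ?index_size // => xy.
  by rewrite -(nth_index x xv) -(nth_index x yv) xy.
have sE : {subset verts E <= vs} by move=> x; rewrite /vs verts_cat mem_cat => ->.
have sE' : {subset verts E' <= vs}.
  by move=> x; rewrite /vs verts_cat mem_cat orbC => ->.
rewrite -(grank_map (sub_in2 sE gI)) -(grank_map (sub_in2 sE' gI)).
set G := map _ E; set G' := map _ E'.
have cGG' : colourings G = colourings G'.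
  by apply/setP=> f; rewrite !inE !compat_map EE'.
have := card_colourings G; rewrite -(card_colourings G') cGG' => /eqP.
rewrite eqn_pmul2l ?eqn_exp2l // => [/eqP //|].
by rewrite card_gt0; apply/set0Pn; exists [ffun => true]; rewrite inE;
   apply/allP => e _; rewrite !ffunE.
Qed.

Lemma grank_pendant E u v : u != v -> v \notin verts E ->
  grank ((u, v) :: E) = (grank E).+1.
Proof.
move=> uv vE; rewrite {1}/grank /= (negbTE uv); congr _.+1.
have := @rank_along_map _ _ id E (merge u v \o id) id.
have -> : [seq (id e.1, id e.2) | e <- E] = E.
  by rewrite -[RHS]map_id; apply: eq_map => -[].
apply=> x y xE yE /=; rewrite /merge.
have -> : (x == v) = false by apply: contraNF vE => /eqP <-.
by have -> : (y == v) = false by apply: contraNF vE => /eqP <-.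
Qed.

End GraphRankTheory.

(** * Contraction of the interior vertices of a tangle *)

Section Normalise.

Variable T : eqType.
Implicit Types (E I : seq (T * T)) (s : T -> T) (f : T -> bool).

Definition nonloop (e : T * T) := e.1 != e.2.

(** An edge from [p] to another vertex is contracted and counted in [n]. If there is none, only
    loops can be left at [p]: in a tangle, this is what remains of a closed circle. *)
Definition contract (p : T) (nJ : nat * seq (T * T)) : nat * seq (T * T) :=
  let: (n, J) := nJ in
  if [seq e <- J | (e.1 == p) != (e.2 == p)] is e :: _ then
    let a := if e.1 == p then e.2 else e.1 in
    (n.+1, [seq d <- [seq (merge a p d.1, merge a p d.2) | d <- J] | nonloop d])
  else (n, [seq d <- J | nonloop d]).

Lemma compat_nonloop f I : compat f (filter nonloop I) = compat f I.
Proof.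
rewrite /compat all_filter; apply: eq_all => e /=; rewrite /nonloop.
by case: eqP => //= ->; rewrite eqxx.
Qed.

(** The contracted graph together with an edge from [a] to [p] has the components of the original
    graph, and [p] is pendant in it. *)
Lemma contractP p n I E : p \notin verts E ->
  (contract p (n, I)).1 + grank ((contract p (n, I)).2 ++ E) =
  n + grank (I ++ E).
Proof.
move=> pE; rewrite /contract.
case def: (filter _ I) => [|e r] /=.
  by congr (_ + _); apply: grank_same => f; rewrite !compat_cat compat_nonloop.
have : e \in filter (fun e => (e.1 == p) != (e.2 == p)) I.
  by rewrite def mem_head.
rewrite mem_filter => /andP[ep eI]; set a := if _ then _ else _.
have ap : a != p.
  by rewrite /a; move: ep; case: (eqVneq e.1 p); case: (eqVneq e.2 p).
rewrite addSnnS; congr (_ + _); rewrite -(@grank_pendant _ _ a p) //.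
  apply: grank_same => f; rewrite /= !compat_cat compat_nonloop andbA.
  congr (_ && _).
  have fae : (f a == f p) = (f e.1 == f e.2).
    rewrite /a; move: ep; case: (eqVneq e.1 p) => [->|_]; first by rewrite eq_sym.
    by case: (eqVneq e.2 p) => [->|].
  have fmerge : f a = f p ->
      compat f [seq (merge a p d.1, merge a p d.2) | d <- I] = compat f I.
    move=> fap; rewrite compat_map; apply: eq_all => d /=; rewrite /merge.
    by case: (d.1 =P p) => [->|_]; case: (d.2 =P p) => [->|_]; rewrite ?fap.
  apply/andP/idP => [[/eqP fap]|cI]; first by rewrite fmerge.
  have fap : f a == f p by rewrite fae; apply: (allP cI).
  by rewrite fap fmerge //; apply/eqP.
rewrite verts_cat mem_cat (negbTE pE) orbF; apply/flattenP => -[x].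
case/mapP=> d; rewrite mem_filter => /andP[_ /mapP[d' _ ->]] ->.
have mp y : (p == merge a p y) = false.
  rewrite /merge eq_sym; case: (eqVneq y p) => [_|/negbTE //].
  exact: negbTE.
by rewrite !inE !mp.
Qed.

(* [norm ps I] contracts the vertices [ps], which are meant to be interior to the
   tangle [I], and counts the contractions: closed loops are what is missing to
   [size ps]. *)
Definition norm ps I := foldl (fun nI p => contract p nI) (0, I) ps.

Lemma normP ps I E : all (fun p => p \notin verts E) ps ->
  grank (I ++ E) = (norm ps I).1 + grank ((norm ps I).2 ++ E).
Proof.
rewrite -[LHS]add0n /norm; elim: ps 0 I => // p ps IH n I /andP[pE psE].
rewrite -(contractP n I pE) [foldl _ _ _]/(foldl _ (contract p (n, I)) ps).
by case: (contract p (n, I)) => n' I'; apply: IH.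
Qed.

(* The edges of [I], listed and oriented as in [L] as far as possible. *)
Definition canon (L I : seq (T * T)) :=
  [seq e <- L | (e \in I) || ((e.2, e.1) \in I)] ++
  [seq e <- I | (e \notin L) && ((e.2, e.1) \notin L)].

(** Compatibility ignores the order, orientation and multiplicity of edges. A common listing makes
    equal pairings of the ends syntactically equal, so that terms of two state sums can be
    matched. *)
Lemma canonP L I : same_comp (canon L I) I.
Proof.
move=> f; rewrite compat_cat /compat !all_filter.
apply/andP/allP => /= [[/allP LI /allP IL] [u v] eI|IE].
  have := IL _ eI => /=; case: (boolP ((u, v) \in L)) => [eL _|_] /=.
    by have := LI _ eL; rewrite /= eI.
  case: (boolP ((v, u) \in L)) => [eL _|_] //=.
  by have := LI _ eL; rewrite /= eI orbT eq_sym.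
split; apply/allP => e eL; apply/implyP => /=; last by move=> _; apply: IE.
by case/orP => /IE //=; rewrite eq_sym.
Qed.

End Normalise.

Arguments canon : simpl never.
Arguments norm : simpl never.

Notation word := (seq (nat * bool)).

(** * The Kauffman bracket of a set of arcs *)

(* [inl 0] is the base point, the other [inl k] are auxiliary cut points;
   [inr (p, false)] enters the endpoint [p] and [inr (p, true)] leaves it. *)
Definition vert := (nat + nat * bool * bool)%type.
Definition edges := seq (vert * vert).

Definition inp (p : nat * bool) : vert := inr (p, false).
Definition outp (p : nat * bool) : vert := inr (p, true).

Fixpoint seg (a : vert) (w : word) (b : vert) : edges :=
  if w is p :: w' then (a, inp p) :: seg (outp p) w' b else [:: (a, b)].

Definition smoothing (oriented : bool) (c : nat) : edges :=
  let p := (c, true) in let q := (c, false) in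
  if oriented then [:: (inp p, outp q); (inp q, outp p)]
  else [:: (inp p, inp q); (outp p, outp q)].

Definition ports (c : nat) : seq vert :=
  [:: inp (c, true); outp (c, true); inp (c, false); outp (c, false)].

Definition avoids (cs : seq nat) (E : edges) :=
  all (fun v => v \notin verts E) (flatten (map ports cs)).

Lemma verts_smoothing o c : {subset verts (smoothing o c) <= ports c}.
Proof.
by move=> v; rewrite /smoothing; case: o; rewrite !inE => /or4P[] ->; rewrite ?orbT.
Qed.

Section Bracket.

Variables (F : fieldType) (A : F).
Implicit Types (e : nat -> sign) (cs : seq nat) (E : edges).

Local Open Scope ring_scope.

Definition loopv : F := - A ^+ 2 - A ^- 2.

(* The chords [cs] remain to be smoothed.  Only ranks are counted at the leaves;
   [kjones] restores the number of vertices. *)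
Fixpoint bracket e cs E : F :=
  if cs is c :: cs' then
    A * bracket e cs' (smoothing (e c == Plus) c ++ E) +
    A^-1 * bracket e cs' (smoothing (e c == Minus) c ++ E)
  else loopv ^- grank E.

Lemma same_comp_catl E E1 E2 : same_comp E1 E2 -> same_comp (E ++ E1) (E ++ E2).
Proof. by move=> H f; rewrite !compat_cat H. Qed.

Lemma same_comp_catr E E1 E2 : same_comp E1 E2 -> same_comp (E1 ++ E) (E2 ++ E).
Proof. by move=> H f; rewrite !compat_cat H. Qed.

Lemma bracket_same e cs E E' : same_comp E E' -> bracket e cs E = bracket e cs E'.
Proof.
elim: cs E E' => [|c cs IH] E E' EE' /=; first by rewrite (grank_same EE').
by congr (_ * _ + _ * _); apply: IH; apply: same_comp_catl.
Qed.

Lemma bracket_ext e e' cs E :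
  {in cs, e =1 e'} -> bracket e cs E = bracket e' cs E.
Proof.
elim: cs E => //= c cs IH E ee'; rewrite ee' ?mem_head //.
by congr (_ * _ + _ * _); apply: IH => d dcs; apply: ee'; rewrite inE dcs orbT.
Qed.

Lemma bracket_catAC e cs E1 E2 E3 :
  bracket e cs (E1 ++ E2 ++ E3) = bracket e cs (E2 ++ E1 ++ E3).
Proof. by apply: bracket_same => f; rewrite !compat_cat andbCA. Qed.

Lemma bracket_swap e c d cs E :
  bracket e (c :: d :: cs) E = bracket e (d :: c :: cs) E.
Proof.
rewrite /= ![bracket e cs (smoothing _ d ++ _)]bracket_catAC; ring.
Qed.

Lemma bracket_perm e cs cs' E :
  perm_eq cs cs' -> bracket e cs E = bracket e cs' E.
Proof.
have mid c r l E' : bracket e (l ++ c :: r) E' = bracket e (c :: l ++ r) E'.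
  elim: l E' => // d l IH E'; rewrite bracket_swap cat_cons.
  by congr (_ * _ + _ * _); apply: IH.
elim: cs cs' E => [|c cs IH] cs' E.
  by move=> /perm_size; case: cs'.
move=> Hp; have : c \in cs' by rewrite -(perm_mem Hp) mem_head.
move=> /splitPr def; case: def Hp => l r.
rewrite perm_sym perm_catC cat_cons perm_cons perm_catC perm_sym => Hp.
by rewrite mid /=; congr (_ * _ + _ * _); apply: IH.
Qed.

(** The vertex [v] stays pendant in every state and adds one to its rank. This is the price of an
    auxiliary cut point. *)
Lemma bracket_pendant e cs E a v : v \notin flatten (map ports cs) ->
  v \notin verts E -> a != v ->
  bracket e cs ((a, v) :: E) = loopv^-1 * bracket e cs E.
Proof.
move=> + + av; elim: cs E => [|c cs IH] E /=.
  by move=> _ vE; rewrite grank_pendant // exprS invfM.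
rewrite !inE !negb_or => /and5P[v1 v2 v3 v4 vcs] vE.
have H o : bracket e cs (smoothing o c ++ (a, v) :: E) =
    loopv^-1 * bracket e cs (smoothing o c ++ E).
  rewrite -IH //; last first.
    rewrite verts_cat mem_cat negb_or vE andbT /smoothing.
    by case: o; rewrite /verts /= !inE !negb_or v1 v2 v3 v4.
  by rewrite -cat1s -[(a, v) :: _]cat1s bracket_catAC.
by rewrite !H; ring.
Qed.

(** [P] marks the ports of a tangle. Smoothing a chord outside the tangle only enlarges the outer
    graph and keeps it away from [P], so an identity valid for every outer graph persists. *)
Lemma bracket_congr e cs t t' (k k' : F) (P : pred vert) E1 E2 E :
  (forall E', {in verts E', forall v, ~~ P v} ->
     k * bracket e t (E1 ++ E') = k' * bracket e t' (E2 ++ E')) ->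
  {in verts E, forall v, ~~ P v} ->
  {in flatten (map ports cs), forall v, ~~ P v} ->
  k * bracket e (cs ++ t) (E1 ++ E) = k' * bracket e (cs ++ t') (E2 ++ E).
Proof.
move=> H; elim: cs E => [|c cs IH] E PE Pcs; first exact: H.
have Pc v : v \in ports c -> ~~ P v.
  by move=> vc; apply: Pcs; rewrite mem_cat vc.
have Psm o : {in verts (smoothing o c ++ E), forall v, ~~ P v}.
  move=> v; rewrite verts_cat mem_cat => /orP[vo|/PE //].
  by apply: Pc; apply: verts_smoothing vo.
have Pcs' : {in flatten (map ports cs), forall v, ~~ P v}.
  by move=> v vcs; apply: Pcs; rewrite /= !inE vcs !orbT.
have step o : k * bracket e (cs ++ t) (smoothing o c ++ E1 ++ E) =
    k' * bracket e (cs ++ t') (smoothing o c ++ E2 ++ E).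
  by rewrite bracket_catAC IH // bracket_catAC.
by rewrite cat_cons [LHS]mulrDr [RHS]mulrDr mulrCA step [X in _ + X]mulrCA step
  !(mulrCA k').
Qed.

End Bracket.

(** * Reidemeister moves on tangles *)

Lemma norm_le (T : eqType) ps (J : seq (T * T)) : (norm ps J).1 <= size ps.
Proof.
rewrite -[size ps]add0n /norm; elim: ps 0 J => [|p ps IH] n J; first by rewrite addn0.
rewrite [foldl _ _ _]/(foldl _ (contract p (n, J)) ps) /= addnS -addSn /contract.
case: (filter _ J) => [|e s]; last exact: IH.
by apply: leq_trans (IH _ _) _; rewrite leq_add2r.
Qed.

(* A state of a tangle: the numbers of its two markers, the number of its
   closed loops, and the way it joins the ends of the tangle. *)
Fixpoint states (e : nat -> sign) (cs : seq nat) (L : edges) (ps : seq vert)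
    (a b : nat) (J : edges) : seq (nat * nat * nat * edges) :=
  if cs is c :: cs' then
    states e cs' L ps a.+1 b (smoothing (e c == Plus) c ++ J) ++
    states e cs' L ps a b.+1 (smoothing (e c == Minus) c ++ J)
  else [:: (a, b, size ps - (norm ps J).1, canon L (norm ps J).2)].

Definition rename (rho : nat -> nat) (v : vert) : vert :=
  if v is inr (c, o, d) then inr (rho c, o, d) else v.

Definition rename_edges (rho : nat -> nat) (E : edges) : edges :=
  [seq (rename rho x.1, rename rho x.2) | x <- E].

Definition rename_word (rho : nat -> nat) (w : word) : word :=
  [seq (rho p.1, p.2) | p <- w].

Lemma rename_seg rho a w b :
  rename_edges rho (seg a w b) = seg (rename rho a) (rename_word rho w) (rename rho
    b).
Proof.
elim: w a => //= -[c o] w IH a; rewrite [LHS]/= -/(rename_edges rho _) IH //.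
Qed.

Section Tangles.

Variables (F : fieldType) (A : F).
Hypothesis A0 : A != 0%R.
Hypothesis loop0 : loopv A != 0%R.
Local Open Scope ring_scope.

(** At a leaf the rank is the number of contractions inside the tangle plus the rank of a graph on
    its ends. Interior vertices left uncontracted are closed loops, which turns the inverse power of
    [loopv A] into a common factor and a positive power. The counters [a] and [b] record the markers
    already chosen. *)
Lemma bracket_states_aux e cs L ps a b J E : all (fun p => p \notin verts E) ps ->
  A ^+ a * A^-1 ^+ b * bracket A e cs (J ++ E) = loopv A ^- size ps *
    \sum_(s <- states e cs L ps a b J)
      A ^+ s.1.1.1 * A^-1 ^+ s.1.1.2 * loopv A ^+ s.1.2 *
      loopv A ^- grank (s.2 ++ E).
Proof.
move=> psE; elim: cs J a b => [|c cs IH] J a b.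
  rewrite big_seq1 [LHS]/= [RHS]mulrC -!mulrA; congr (_ * (_ * _)).
  have -> : grank (canon L (norm ps J).2 ++ E) = grank ((norm ps J).2 ++ E).
    exact/grank_same/same_comp_catr/canonP.
  rewrite (normP J psE) exprD invfM [LHS]mulrC [RHS]mulrCA /=; congr (_ * _).
  have := norm_le ps J; move: (norm ps J).1 (size ps) => n N nN.
  rewrite -{2}(subnK nN) exprD invfM mulrA divff ?mul1r //.
  exact: expf_neq0.
rewrite big_cat /= 2!mulrDr -!IH !exprS -!catA; ring.
Qed.

Lemma bracket_states e cs L ps J E : all (fun p => p \notin verts E) ps ->
  bracket A e cs (J ++ E) = loopv A ^- size ps *
    \sum_(s <- states e cs L ps 0 0 J)
      A ^+ s.1.1.1 * A^-1 ^+ s.1.1.2 * loopv A ^+ s.1.2 *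
      loopv A ^- grank (s.2 ++ E).
Proof. by move=> psE; rewrite -bracket_states_aux // !expr0 !mul1r. Qed.

Lemma bracket_rename e e' rho cs E :
  {in verts E ++ flatten (map ports cs) &, injective (rename rho)} ->
  {in cs, forall c, e' (rho c) = e c} ->
  bracket A e' (map rho cs) (rename_edges rho E) = bracket A e cs E.
Proof.
elim: cs E => [|c cs IH] E rI ee' /=.
  by rewrite grank_map // => u v uE vE; apply: rI; rewrite mem_cat ?uE ?vE.
have sm o : smoothing o (rho c) ++ rename_edges rho E =
    rename_edges rho (smoothing o c ++ E).
  by rewrite /smoothing; case: o.
rewrite ee' ?mem_head // !sm !IH // => [|d dcs||d dcs];
  try by apply: ee'; rewrite inE dcs orbT.
all: apply: sub_in2 rI => u; rewrite verts_cat !mem_cat -orbA.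
all: by case/or3P=> [/verts_smoothing||] ->; rewrite ?orbT.
Qed.

Definition state_sum (S : seq (nat * nat * nat * edges)) (E : edges) : F :=
  \sum_(s <- S) A ^+ s.1.1.1 * A^-1 ^+ s.1.1.2 * loopv A ^+ s.1.2 *
    loopv A ^- grank (s.2 ++ E).

Lemma eq_state_sum S S1 S' S1' E :
  S = S1 -> S' = S1' -> state_sum S1 E = state_sum S1' E ->
  state_sum S E = state_sum S' E.
Proof. by move=> -> ->. Qed.

(** All pairs [i < j] among the six ends of a third move. The tangles of the other moves use some of
    these ends, so this order serves them too. *)
Definition ends3 : edges :=
  [seq (inl i, inl j) | i <- iota 1 5, j <- iota i.+1 (6 - i)].

Definition R3tangle (t m b : bool) (x y z : nat) : edges :=
  seg (inl 1%N) (strand t (x, true) (y, true)) (inl 2%N) ++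
  seg (inl 3%N) (strand m (x, false) (z, true)) (inl 4%N) ++
  seg (inl 5%N) (strand b (y, false) (z, false)) (inl 6%N).

(** The move reverses the order of the two crossings on each strand, which negates the three flags.
    The sign conditions leave sixteen cases, each a finite computation. *)
Lemma bracket_R3_012 e t m b E : avoids [:: 0; 1; 2]%N E ->
  same t (e 2%N) = same m (e 1%N) -> same m (e 1%N) = same b (e 0%N) ->
  bracket A e [:: 0; 1; 2]%N (R3tangle t m b 0 1 2 ++ E) =
  bracket A e [:: 0; 1; 2]%N (R3tangle (~~ t) (~~ m) (~~ b) 0 1 2 ++ E).
Proof.
rewrite /avoids => pE H1 H2.
pose e' c := nth Plus [:: e 0; e 1; e 2]%N c.
have ee' : {in [:: 0; 1; 2]%N, e =1 e'}.
  by move=> c; rewrite !inE => /or3P[] /eqP ->.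
rewrite !(bracket_ext _ _ ee') {ee'} /e' {e'}.
apply: etrans (bracket_states _ _ ends3 _ pE) _.
apply: etrans (esym (bracket_states _ _ ends3 _ pE)).
congr (_ * _); rewrite -/(state_sum _ E) -/(state_sum _ E).
case: (e 0%N) (e 1%N) (e 2%N) t m b H1 H2 => [] [] [] [] [] [] H1 H2;
  try discriminate H1; try discriminate H2.
(* The lists of states are evaluated alone, before the abstract field and the outer graph come into
   play. *)
all: match goal with |- state_sum ?X _ = state_sum ?Y _ =>
  let X' := eval vm_compute in X in let Y' := eval vm_compute in Y in
  apply: (@eq_state_sum X X' Y Y'); [by vm_compute|by vm_compute|] end.
all: rewrite /state_sum !big_cons !big_nil; cbn [fst snd].
(* The outer graph is arbitrary, so the factor belonging to each pairing of the ends is treated as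
   an unknown. The rest is a rational identity in [A], linear in these unknowns. *)
all: repeat match goal with |- context [GRing.inv (loopv A ^+ grank ?X)] =>
  generalize (GRing.inv (loopv A ^+ grank X)); intro end.
all: rewrite /loopv; field; exact: A0.
Qed.

End Tangles.

Lemma rename_inj rho : injective rho -> injective (rename rho).
Proof. by move=> rI [k|[[c o] d]] [l|[[c' o'] d']] //= [] => [/rI -> -> ->]. Qed.

Lemma verts_rename rho E : verts (rename_edges rho E) = map (rename rho) (verts E).
Proof. by rewrite /verts /rename_edges map_flatten -!map_comp. Qed.

Lemma ports_rename rho cs :
  flatten (map ports (map rho cs)) = map (rename rho) (flatten (map ports cs)).
Proof. by elim: cs => //= c cs ->. Qed.

Lemma avoids_rename rho cs E : injective rho ->
  avoids (map rho cs) (rename_edges rho E) = avoids cs E.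
Proof.
move=> /rename_inj rI; rewrite /avoids ports_rename all_map; apply: eq_all => v /=.
by rewrite verts_rename mem_map.
Qed.

(* An injection sending [s] to [0], [1], ...: tangle identities are computed on
   concrete chords. *)
Definition compress (s : seq nat) (c : nat) : nat :=
  if c \in s then index c s else c + size s.

Lemma compress_inj s : injective (compress s).
Proof.
move=> c d; rewrite /compress; case: ifP => cs; case: ifP => ds.
- by move=> H; rewrite -(nth_index 0 cs) H nth_index.
- move=> H; have : index c s < size s by rewrite index_mem.
  by rewrite H; lia.
- move=> H; have : index d s < size s by rewrite index_mem.
  by rewrite -H; lia.
- lia.
Qed.

Lemma map_compress s : uniq s -> map (compress s) s = iota 0 (size s).
Proof.
move=> Us; apply: (@eq_from_nth _ 0); rewrite ?size_map ?size_iota // => i si.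
by rewrite (nth_map 0) // nth_iota // /compress mem_nth // index_uniq.
Qed.

Section Tangles.

Variables (F : fieldType) (A : F).
Hypothesis A0 : A != 0%R.
Hypothesis loop0 : loopv A != 0%R.
Local Open Scope ring_scope.

Lemma bracket_compress e e' s E : uniq s ->
  {in s, forall c, e' (compress s c) = e c} ->
  bracket A e s E = bracket A e' (iota 0 (size s)) (rename_edges (compress s) E).
Proof.
move=> Us ee'; rewrite -map_compress // (bracket_rename _ _ ee') //.
by move=> u v _ _; apply/rename_inj/compress_inj.
Qed.

Lemma sign_compress e s : uniq s ->
  {in s, forall c, nth Plus (map e s) (compress s c) = e c}.
Proof.
move=> Us c cs; rewrite /compress cs (nth_map 0%N) ?index_mem //.
by rewrite nth_index.
Qed.

Lemma bracket_R3 e x y z t m b E : uniq [:: x; y; z] -> avoids [:: x; y; z] E ->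
  same t (e z) = same m (e y) -> same m (e y) = same b (e x) ->
  bracket A e [:: x; y; z] (R3tangle t m b x y z ++ E) =
  bracket A e [:: x; y; z] (R3tangle (~~ t) (~~ m) (~~ b) x y z ++ E).
Proof.
set s := [:: x; y; z] => Us sE H1 H2.
rewrite !(bracket_compress _ Us (sign_compress e Us)).
have tE t' m' b' : rename_edges (compress s) (R3tangle t' m' b' x y z ++ E) =
    R3tangle t' m' b' 0 1 2 ++ rename_edges (compress s) E.
  rewrite /rename_edges map_cat; congr (_ ++ _).
  rewrite /R3tangle !map_cat -!/(rename_edges _ _) !rename_seg.
  have [rx ry rz] : [/\ compress s x = 0%N, compress s y = 1%N & compress s z = 2%N].
    by have [] := map_compress Us.
  by case: t'; case: m'; case: b'; rewrite /= rx ry rz.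
rewrite !tE; apply: bracket_R3_012 => //.
by rewrite -[[:: _; _; _]](map_compress Us) avoids_rename //; apply: compress_inj.
Qed.

Definition R2tangle (o d : bool) (x y : nat) : edges :=
  seg (inl 1%N) [:: (x, o); (y, o)] (inl 2%N) ++
  seg (inl 3%N) (strand d (x, ~~ o) (y, ~~ o)) (inl 4%N).

(** Three of the four states pair the ends in the same way, with weights [A^2], [A^-2] and
    [loopv A], which sum to zero; the fourth has weight 1 and gives back the two strands. The
    exponent 8 counts the ports of the two chords. *)
Lemma bracket_R2_01 e o d E : avoids [:: 0; 1]%N E -> e 0%N != e 1%N ->
  bracket A e [:: 0; 1]%N (R2tangle o d 0 1 ++ E) =
  loopv A ^- 8 * bracket A e [::]
    (seg (inl 1%N) [::] (inl 2%N) ++ seg (inl 3%N) [::] (inl 4%N) ++ E).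
Proof.
rewrite /avoids => pE ne.
pose e' c := nth Plus [:: e 0; e 1]%N c.
have ee' : {in [:: 0; 1]%N, e =1 e'} by move=> c; rewrite !inE => /orP[] /eqP ->.
rewrite (bracket_ext _ _ ee') {ee'} /e' {e'}.
rewrite (bracket_states loop0 _ _ ends3 (R2tangle o d 0 1) pE).
congr (_ * _); rewrite -/(state_sum _ _ E).
case: (e 0%N) (e 1%N) o d ne => [] [] [] [] ne; try discriminate ne.
all: match goal with |- state_sum _ ?X _ = _ =>
  let X' := eval vm_compute in X in
  apply: etrans (congr1 (state_sum A ^~ E) (_ : X = X')) _; [by vm_compute|] end.
all: rewrite /state_sum !big_cons !big_nil; cbn [fst snd bracket seg cat].
all: repeat match goal with |- context [GRing.inv (loopv A ^+ grank ?X)] =>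
  generalize (GRing.inv (loopv A ^+ grank X)); intro end.
all: rewrite /loopv; field; exact: A0.
Qed.

Lemma bracket_R2 e x y o d E : avoids [:: x; y] E -> e x != e y ->
  bracket A e [:: x; y] (R2tangle o d x y ++ E) =
  loopv A ^- 8 * bracket A e [::]
    (seg (inl 1%N) [::] (inl 2%N) ++ seg (inl 3%N) [::] (inl 4%N) ++ E).
Proof.
set s := [:: x; y] => sE ne.
have Us : uniq s by rewrite /= inE andbT; apply: contraNneq ne => ->.
rewrite !(bracket_compress _ Us (sign_compress e Us)).
have -> : rename_edges (compress s) (R2tangle o d x y ++ E) =
    R2tangle o d 0 1 ++ rename_edges (compress s) E.
  rewrite /rename_edges map_cat; congr (_ ++ _).
  rewrite /R2tangle !map_cat -!/(rename_edges _ _) !rename_seg.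
  have [rx ry] : compress s x = 0%N /\ compress s y = 1%N by have [] := map_compress
    Us.
  by case: d; rewrite /= rx ry.
rewrite bracket_R2_01 //; last first.
  by rewrite -[[:: _; _]](map_compress Us) avoids_rename //; apply: compress_inj.
congr (_ * _).
by rewrite -(@bracket_rename _ A e e (compress s) [::]) // => u v _ _;
  apply/rename_inj/compress_inj.
Qed.

(** The oriented smoothing of a kink splits off a circle. For a positive kink the weights add up to
    [A * loopv A + A^-1 = - A^3], for a negative one to the inverse. The exponent 4 counts the ports
    of the chord. *)
Lemma bracket_R1_0 e o E : avoids [:: 0]%N E ->
  bracket A e [:: 0]%N (seg (inl 1%N) [:: (0, o); (0, ~~ o)]%N (inl 2%N) ++ E) =
  loopv A ^- 4 * (- A ^+ 3) ^ signz (e 0%N) *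
  bracket A e [::] (seg (inl 1%N) [::] (inl 2%N) ++ E).
Proof.
rewrite /avoids => pE.
pose e' c := nth Plus [:: e 0]%N c.
have ee' : {in [:: 0]%N, e =1 e'} by move=> c; rewrite !inE => /eqP ->.
rewrite (bracket_ext _ _ ee') {ee'} /e' {e'}.
apply: etrans (bracket_states loop0 _ _ ends3 _ pE) _.
rewrite -mulrA; congr (_ * _); rewrite -/(state_sum _ _ E).
case: (e 0%N) o => [] [].
all: match goal with |- state_sum _ ?X _ = _ =>
  let X' := eval vm_compute in X in
  apply: etrans (congr1 (state_sum A ^~ E) (_ : X = X')) _; [by vm_compute|] end.
all: rewrite /state_sum !big_cons !big_nil; cbn [fst snd bracket seg cat signz].
all: repeat match goal with |- context [GRing.inv (loopv A ^+ grank ?X)] =>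
  generalize (GRing.inv (loopv A ^+ grank X)); intro end.
all: rewrite /loopv ?expr1z ?exprN1; field; rewrite ?oppr_eq0 ?expf_neq0 ?A0 //.
Qed.

Lemma bracket_R1 e x o E : avoids [:: x] E ->
  bracket A e [:: x] (seg (inl 1%N) [:: (x, o); (x, ~~ o)]%N (inl 2%N) ++ E) =
  loopv A ^- 4 * (- A ^+ 3) ^ signz (e x) *
  bracket A e [::] (seg (inl 1%N) [::] (inl 2%N) ++ E).
Proof.
set s := [:: x] => sE; have Us : uniq s by [].
rewrite !(bracket_compress _ Us (sign_compress e Us)).
have -> : rename_edges (compress s) (seg (inl 1%N) [:: (x, o);
  (x, ~~ o)]%N (inl 2%N) ++ E) =
    seg (inl 1%N) [:: (0, o); (0, ~~ o)]%N (inl 2%N) ++ rename_edges (compress s) E.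
  rewrite /rename_edges map_cat -!/(rename_edges _ _) !rename_seg.
  have rx : compress s x = 0%N by have [] := map_compress Us.
  by rewrite /= rx.
rewrite bracket_R1_0 //; last first.
  by rewrite -[[:: _]](map_compress Us) avoids_rename //; apply: compress_inj.
congr (_ * _).
by rewrite -(@bracket_rename _ A e e (compress s) [::]) // => u v _ _;
  apply/rename_inj/compress_inj.
Qed.

End Tangles.

Lemma inl_verts_seg k a w b :
  (inl k \in verts (seg a w b)) = (inl k == a) || (inl k == b).
Proof.
elim: w a => [|p w IH] a; first by rewrite !inE.
by rewrite [verts _]/= !inE -/(verts _) IH.
Qed.

Lemma inr_verts_seg p d k w l :
  inr (p, d) \in verts (seg (inl k) w (inl l)) -> p \in w.
Proof.
suff H a : inr (p, d) \in verts (seg a w (inl l)) -> (inr (p, d) == a) || (p \in w).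
  by move/H.
elim: w a => [|q w IH] a; first by rewrite !inE => /orP[->|].
rewrite [verts _]/= !inE -/(verts _) => /or3P[->//|/eqP[-> _]|/IH].
  by rewrite eqxx orbT.
by case/orP=> [/eqP[-> _]|->]; rewrite ?eqxx ?orbT.
Qed.

(** The point [d] subdivides the edge between [u] and [v]; up to components it is a pendant vertex
    attached to the end of [u]. *)
Lemma compat_seg_cut f a u d v b :
  compat f (seg a u d ++ seg d v b) =
  compat f ((last a (map outp u), d) :: seg a (u ++ v) b).
Proof.
elim: u a => [|p u IH] a /=; last by rewrite IH /= andbCA.
have [fad|] := eqVneq (f a) (f d); rewrite ?andbF //=.
by case: v => [|q v] /=; rewrite fad.
Qed.

(** * Cutting the line around the strands of a move *)

(* A strand [s] between the cut points [d] and [d'], and the part [w] of the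
   word that follows it. *)
Definition cutting := seq (nat * nat * word * word).

Definition glue (w0 : word) (L : cutting) : word :=
  w0 ++ flatten [seq x.1.2 ++ x.2 | x <- L].

Definition inner (L : cutting) : edges :=
  flatten [seq seg (inl x.1.1.1) x.1.2 (inl x.1.1.2) | x <- L].

Fixpoint outer (a : nat) (w0 : word) (L : cutting) : edges :=
  if L is x :: L' then seg (inl a) w0 (inl x.1.1.1) ++ outer x.1.1.2 x.2 L'
  else seg (inl a) w0 (inl 0).

Definition cuts (L : cutting) : seq nat := flatten [seq [:: x.1.1.1;
  x.1.1.2] | x <- L].

Lemma inr_verts_outer p d a w0 L : inr (p, d) \in verts (outer a w0 L) ->
  p \in w0 ++ flatten [seq x.2 | x <- L].
Proof.
elim: L a w0 => [|x L IH] a w0 /=; first by rewrite cats0 => /inr_verts_seg.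
rewrite verts_cat mem_cat [in X in _ -> X]mem_cat.
by case/orP=> [/inr_verts_seg ->|/IH ->]; rewrite ?orbT.
Qed.

Section Cut.

Variables (F : fieldType) (A : F).
Hypothesis loop0 : loopv A != 0%R.
Local Open Scope ring_scope.

Lemma inl_notin_ports k cs : inl k \notin flatten (map ports cs).
Proof. by elim: cs. Qed.

Lemma bracket_cut1 e cs a u k v b E :
  inl k \notin verts (seg a (u ++ v) b ++ E) ->
  bracket A e cs (seg a (u ++ v) b ++ E) =
  loopv A * bracket A e cs (seg a u (inl k) ++ seg (inl k) v b ++ E).
Proof.
move=> kE; have kl : last a (map outp u) != inl k.
  case: (lastP u) => [|u' p]; last by rewrite map_rcons last_rcons.
  apply: contraNneq kE => /= ->; rewrite verts_cat mem_cat inl_verts_seg.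
  by rewrite eqxx.
have := bracket_pendant A e (inl_notin_ports k cs) kE kl.
rewrite (bracket_same A e cs (E' := seg a u (inl k) ++ seg (inl k) v b ++ E)).
  by move=> ->; rewrite mulrA divff ?mul1r.
by move=> f; rewrite catA [RHS]compat_cat compat_seg_cut -compat_cat.
Qed.

(** Each strand is enclosed between two fresh cut points, and [bracket_cut1] gives one factor
    [loopv A] for each of them. *)
Lemma bracket_cut e cs a w0 L E : uniq (cuts L) ->
  {in cuts L, forall k, [/\ k != 0%N, k != a & inl k \notin verts E]} ->
  bracket A e cs (seg (inl a) (glue w0 L) (inl 0%N) ++ E) =
  loopv A ^+ (2 * size L) * bracket A e cs (inner L ++ outer a w0 L ++ E).
Proof.
elim: L a w0 E => [|[[[d d'] s] w] L IH] a w0 E.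
  by rewrite /glue /= cats0 mul1r.
rewrite [cuts _]/= -/(cuts _) => /=; rewrite inE negb_or.
move=> /and3P[/andP[dd' dL] d'L UL] kE.
have [d0 da dE] := kE d (mem_head _ _).
have [d'0 d'a d'E] : [/\ d' != 0%N, d' != a & inl d' \notin verts E].
  by apply: kE; rewrite !inE eqxx orbT.
have inlE (k l : nat) : (inl k == inl l :> vert) = (k == l) by [].
rewrite /glue /= (bracket_cut1 _ _ (k := d)) ?(verts_cat, mem_cat, inl_verts_seg,
  inlE, negb_or, dE, d0, da) //.
rewrite -catA bracket_catAC (bracket_cut1 _ _ (k := d')); last first.
  by rewrite !(verts_cat, mem_cat, inl_verts_seg, inlE, negb_or, d'E, d'0, d'a)
    eq_sym dd'.
rewrite bracket_catAC -/(glue w L) IH //; last first.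
  move=> k kL; have [k0 ka kE'] : [/\ k != 0%N, k != a & inl k \notin verts E].
    by apply: kE; rewrite !inE kL !orbT.
  have kd : k != d by apply: contraNneq dL => <-.
  have kd' : k != d' by apply: contraNneq d'L => <-.
  by rewrite !(verts_cat, mem_cat, inl_verts_seg, inlE, negb_or, k0, ka, kE', kd,
    kd').
rewrite [size _]/= mulnS exprD expr2 -!mulrA; congr (_ * (_ * (_ * _))).
apply: bracket_same => f; rewrite /inner /= -/(inner L) !compat_cat.
by do !bool_congr.
Qed.

End Cut.

Lemma chord_notin (w s r : word) x : uniq w -> perm_eq w (s ++ r) ->
  (forall o, (x, o) \in s) -> x \notin map fst r.
Proof.
move=> Uw wp xs; move: Uw; rewrite (perm_uniq wp) cat_uniq => /and3P[_ /hasPn sr _].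
apply/mapP => -[[c o] cr /= xc]; have := sr _ cr.
by rewrite /= -xc xs.
Qed.

Lemma notin_map_fstP (T U : eqType) x (w : seq (T * U)) :
  reflect (forall o, (x, o) \notin w) (x \notin map fst w).
Proof.
apply: (iffP idP) => [xw o|xw]; first by apply: contra xw => /(map_f fst).
by apply/mapP => -[[c o] cw xc]; have := xw o; rewrite xc cw.
Qed.

Lemma rev_strand (T : eqType) d (u v : T) : rev (strand d u v) = strand (~~ d) u v.
Proof. by case: d. Qed.

Lemma perm_eq3 (T : eqType) (s1 s2 s3 a b c : T) : perm_eq [:: s1; s2; s3] [:: a; b;
  c] ->
  [\/ [/\ s1 = a, s2 = b & s3 = c], [/\ s1 = a, s2 = c & s3 = b],
      [/\ s1 = b, s2 = a & s3 = c] | [/\ s1 = b, s2 = c & s3 = a]] \/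
  ([/\ s1 = c, s2 = a & s3 = b] \/ [/\ s1 = c, s2 = b & s3 = a]).
Proof.
have P2 (u v p q : T) : perm_eq [:: u; v] [:: p; q] ->
    [/\ u = p & v = q] \/ [/\ u = q & v = p].
  move=> Hp; have : u \in [:: p; q] by rewrite -(perm_mem Hp) mem_head.
  rewrite !inE => /orP[] /eqP eu; move: Hp; rewrite eu.
    by rewrite perm_cons => /perm_small_eq -/(_ isT) [->]; left.
  rewrite -[[:: p; q]]cat1s perm_sym perm_catC /= perm_cons perm_sym.
  move=> /perm_mem /(_ v); rewrite !inE eqxx => /esym/eqP vp; by right.
move=> Hp; have : s1 \in [:: a; b; c] by rewrite -(perm_mem Hp) mem_head.
rewrite !inE => /or3P[] /eqP e1; move: Hp; rewrite e1.
- by rewrite perm_cons => /P2[] [-> ->]; left; [constructor 1|constructor 2].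
- rewrite perm_sym -[[:: a; b; c]](cat1s a) perm_catC /= perm_cons.
  move=> Hp; have /P2 : perm_eq [:: s2; s3] [:: a; c].
    by rewrite perm_sym; apply: perm_trans Hp; rewrite -[[:: a; c]]cat1s perm_catC.
  by case=> -[-> ->]; left; [constructor 3|constructor 4].
- rewrite perm_sym -[[:: a; b; c]](cat_rcons c [:: a; b] [::]) /=.
  rewrite -[[:: a; b; c]]/([:: a; b] ++ [:: c]) perm_catC /= perm_cons perm_sym.
  by case/P2=> -[-> ->]; right; [left|right].
Qed.

Lemma perm_R2 (w0 w1 w2 : word) x y o d :
  perm_eq (w0 ++ [:: (x, o); (y, o)] ++ w1 ++ strand d (x, ~~ o) (y, ~~ o) ++ w2)
    (([:: (x, o); (y, o)] ++ strand d (x, ~~ o) (y, ~~ o)) ++ (w0 ++ w1 ++ w2)).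
Proof. by apply/permP => p; rewrite !count_cat; lia. Qed.

Lemma R2_notin (w0 w1 w2 : word) x y o d c :
  uniq (w0 ++ [:: (x, o); (y, o)] ++ w1 ++ strand d (x, ~~ o) (y, ~~ o) ++ w2) ->
  c \in [:: x; y] -> c \notin map fst (w0 ++ w1 ++ w2).
Proof.
move=> Uw cxy; apply: chord_notin Uw (perm_R2 _ _ _ _ _ _ _) _ => o'.
move: cxy; rewrite !inE => /orP[] /eqP ->; case: d; rewrite /= !inE !xpair_eqE eqxx;
  by case: o; case: o'; rewrite ?orbT.
Qed.

(** * Invariance of the normalised bracket under the moves *)

Section Moves.

Variables (F : fieldType) (A : F).
Hypothesis A0 : A != 0%R.
Hypothesis loop0 : loopv A != 0%R.
Local Open Scope ring_scope.

(** The two cuttings share their cut points and the words between the strands, so the outer graph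
    and the powers of [loopv A] from the cuts agree. Neither this graph nor the chords [cs] meet the
    ports of [t], and the local identity extends by [bracket_congr]. *)
Lemma bracket_tangle e cs t t' (k k' : F) w0 L L' :
  {in t, forall c, c \notin cs} ->
  {in t, forall c, c \notin map fst (w0 ++ flatten (map snd L))} ->
  uniq (0%N :: cuts L) -> cuts L' = cuts L -> map snd L' = map snd L ->
  (forall E, avoids t E ->
     k * bracket A e t (inner L ++ E) = k' * bracket A e t' (inner L' ++ E)) ->
  k * bracket A e (cs ++ t) (seg (inl 0%N) (glue w0 L) (inl 0%N)) =
  k' * bracket A e (cs ++ t') (seg (inl 0%N) (glue w0 L') (inl 0%N)).
Proof.
move=> tcs tw /andP[L0 UL] cL' wL' H.
have cut M : cuts M = cuts L ->
    forall cs, bracket A e cs (seg (inl 0%N) (glue w0 M) (inl 0%N)) =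
    loopv A ^+ (2 * size M) * bracket A e cs (inner M ++ outer 0 w0 M).
  move=> cM cs'; rewrite -[seg _ _ _]cats0 bracket_cut // ?cM ?cats0 // => k1 kL.
  by have k0 : k1 != 0%N by apply: contraNneq L0 => <-.
have oL' a u : outer a u L' = outer a u L.
  rewrite /= {H cut tw L0 UL}; elim: L L' a u cL' wL' => [|[[[d d'] s] w] M IH] [|x'
    M'] a u //=.
  by case=> -> ->; rewrite -/(cuts _) -/(cuts _) => cM [-> wM]; rewrite (IH M').
have sL' : size L' = size L by rewrite -(size_map snd L') wL' size_map.
rewrite !cut // oL' sL' mulrCA [RHS]mulrCA; congr (_ * _).
apply: (bracket_congr (P := mem (flatten (map ports t)))).
- move=> E' E't; apply: H; apply/allP => v vt; apply/negP => vE'.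
  by move/negP: (E't v vE'); apply.
- move=> v vo; apply/flattenP => -[_ /mapP[c ct ->]] vc.
  have /notin_map_fstP cw := tw c ct.
  move: vo; move: vc; rewrite !inE => /or4P[] /eqP -> /inr_verts_outer;
    exact/negP/cw.
- move=> v /flattenP[_ /mapP[c ccs ->]] vc; apply/flattenP => -[_ /mapP[d dt ->]] vd.
  have := tcs d dt; have -> : d = c; last by rewrite ccs.
  by move: vc vd; rewrite !inE => /or4P[] /eqP -> /or4P[] /eqP [].
Qed.

(** The vertices are the two sides of each endpoint and the base point, [2 * size w + 1] in all. A
    state thus has this number minus its rank as number of circles, and the base point accounts for
    the [-1] in the Kauffman exponent. *)
Definition kjones (e : nat -> sign) (cs : seq nat) (w : word) : F :=
  (- A ^+ 3) ^ (- \sum_(c <- cs) signz (e c)) * loopv A ^+ (2 * size w) *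
  bracket A e cs (seg (inl 0%N) w (inl 0%N)).

Lemma kjones_perm e cs cs' w : perm_eq cs cs' -> kjones e cs w = kjones e cs' w.
Proof.
by move=> H; rewrite /kjones (bracket_perm _ _ _ H) (perm_big _ H).
Qed.

Lemma kjones_ext e e' cs w : {in cs, e =1 e'} -> kjones e cs w = kjones e' cs w.
Proof.
move=> H; rewrite /kjones (bracket_ext _ _ H); congr (_ ^ (- _) * _ * _).
by apply: eq_big_seq => c /H ->.
Qed.

Lemma signz_opp (s s' : sign) : s != s' -> signz s + signz s' = 0.
Proof. by case: s; case: s'. Qed.

(** The writhe factor of the new chord cancels the factor of the kink, and its four vertices cancel
    [loopv A ^- 4]. *)
Lemma kjones_R1 e w0 w1 x o : let w := w0 ++ [:: (x, o); (x, ~~ o)] ++ w1 in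
  uniq w -> kjones e (undup (map fst (w0 ++ w1))) (w0 ++ w1) =
            kjones e (undup (map fst w)) w.
Proof.
move=> w Uw; set cs := undup _.
have xw : x \notin map fst (w0 ++ w1).
  apply: (@chord_notin w [:: (x, o); (x, ~~ o)]) => //; first by rewrite perm_catCA.
  by move=> o'; rewrite !inE !xpair_eqE eqxx /=; case: {w Uw} o; case: o'.
have xcs : x \notin cs by rewrite mem_undup.
have pcs : perm_eq (undup (map fst w)) (cs ++ [:: x]).
  apply: uniq_perm; rewrite ?undup_uniq //.
    by rewrite cat_uniq undup_uniq /= orbF xcs.
  move=> c; rewrite mem_cat !mem_undup /w !map_cat !mem_cat !inE /=.
  by move: (c \in map fst w0) (c \in map fst w1) (c == x) => [] [] [].
rewrite (kjones_perm _ _ pcs) /kjones big_cat big_seq1 /= opprD expfzDr ?oppr_eq0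
  ?expf_neq0 //.
have := @bracket_tangle e cs [:: x] [::] (loopv A ^+ 4) ((- A ^+ 3) ^ signz (e x)) w0
  [:: (1, 2, [:: (x, o); (x, ~~ o)], w1)]%N [:: (1, 2, [::], w1)]%N.
rewrite /glue /= !cats0 => H.
rewrite -[w]/(w0 ++ [:: (x, o), (x, ~~ o) & w1]).
have -> : (2 * size (w0 ++ [:: (x, o), (x, ~~ o) & w1]) = 2 * size (w0 ++ w1) + 4)%N.
  by rewrite !size_cat /=; lia.
rewrite exprD; set X := bracket _ _ _ _; set Y := bracket _ _ _ _ in H *.
have {}H : loopv A ^+ 4 * Y = (- A ^+ 3) ^ signz (e x) * X.
  apply: H => // [c|c|E avE]; rewrite ?inE.
  - by move/eqP=> ->.
  - by move/eqP=> ->.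
  have := bracket_R1 A0 loop0 e o avE; rewrite /= => ->.
  by rewrite !mulrA divff ?mul1r ?expf_neq0.
move: X Y H; set a := _ ^ (- _); set s := signz _ => X Y H.
have u : (- A ^+ 3) ^ (- s) * (- A ^+ 3) ^ s = 1.
  by rewrite -expfzDr ?oppr_eq0 ?expf_neq0 // addNr.
transitivity (a * loopv A ^+ (2 * size (w0 ++ w1)) * ((- A ^+ 3) ^ (- s)) *
  (loopv A ^+ 4 * Y)); last by ring.
by rewrite H -!mulrA [(- A ^+ 3) ^ (- s) * _]mulrA u mul1r.
Qed.

End Moves.

Lemma perm_strand (T : eqType) d (u v : T) : perm_eq (strand d u v) [:: u; v].
Proof. by case: d => //; rewrite -[strand _ _ _]/([:: v] ++ [:: u]) perm_catC. Qed.

Lemma perm_undup (T : eqType) (s s' : seq T) : s =i s' -> perm_eq (undup s) (undup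
  s').
Proof. by move=> H; apply: uniq_perm; rewrite ?undup_uniq // => c;
  rewrite !mem_undup. Qed.

Lemma perm_R3 (s1 s2 s3 : word) x y z t m b :
  perm_eq [:: s1; s2; s3]
      [:: strand t (x, true) (y, true);
          strand m (x, false) (z, true);
          strand b (y, false) (z, false)] ->
  perm_eq (s1 ++ s2 ++ s3)
    [:: (x, true); (y, true); (x, false); (z, true); (y, false); (z, false)].
Proof.
move=> ps; have := perm_flatten ps; rewrite /= !cats0 => /perm_trans; apply.
rewrite -[X in perm_eq _ X]/([:: _; _] ++ [:: _; _] ++ [:: _; _]).
by do 2?apply: perm_cat; apply: perm_strand.
Qed.

Lemma perm_strands (w0 w1 w2 w3 s1 s2 s3 : word) :
  perm_eq (w0 ++ s1 ++ w1 ++ s2 ++ w2 ++ s3 ++ w3)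
    ((s1 ++ s2 ++ s3) ++ (w0 ++ w1 ++ w2 ++ w3)).
Proof. by apply/permP => p; rewrite !count_cat; lia. Qed.

Lemma R3_uniq (w0 w1 w2 w3 s1 s2 s3 : word) x y z :
  uniq (w0 ++ s1 ++ w1 ++ s2 ++ w2 ++ s3 ++ w3) ->
  perm_eq (s1 ++ s2 ++ s3)
    [:: (x, true); (y, true); (x, false); (z, true); (y, false); (z, false)] ->
  uniq [:: x; y; z] /\
  {in [:: x; y; z], forall c, c \notin map fst (w0 ++ w1 ++ w2 ++ w3)}.
Proof.
move=> Uw ps; have pw := perm_strands w0 w1 w2 w3 s1 s2 s3; split.
  have := Uw; rewrite (perm_uniq pw) cat_uniq => /and3P[+ _ _].
  rewrite (perm_uniq ps) => U6; rewrite /= !inE negb_or -andbA andbT.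
  by apply/and3P; split; apply: contraTneq U6 => -> /=;
    rewrite !inE eqxx ?orbT ?andbF.
move=> c cs; apply: chord_notin Uw pw _ => o; rewrite (perm_mem ps) !inE !xpair_eqE.
by move: cs; rewrite !inE => /or3P[] ->; case: o; rewrite ?orbT.
Qed.

Section Moves.

Variables (F : fieldType) (A : F).
Hypothesis A0 : A != 0%R.
Hypothesis loop0 : loopv A != 0%R.
Local Open Scope ring_scope.

(** The two new signs cancel in the writhe, and the eight new vertices cancel [loopv A ^- 8]. *)
Lemma kjones_R2 e w0 w1 w2 x y o d :
  let w := w0 ++ [:: (x, o); (y, o)] ++ w1 ++ strand d (x, ~~ o) (y, ~~ o) ++ w2 in
  uniq w -> e x != e y ->
  kjones A e (undup (map fst (w0 ++ w1 ++ w2))) (w0 ++ w1 ++ w2) =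
  kjones A e (undup (map fst w)) w.
Proof.
move=> w Uw ne; set cs := undup _.
have pw : perm_eq w _ := perm_R2 w0 w1 w2 x y o d.
have xw : x \notin map fst (w0 ++ w1 ++ w2) by apply: (R2_notin Uw); rewrite mem_head.
have yw : y \notin map fst (w0 ++ w1 ++ w2).
  by apply: (R2_notin Uw); rewrite !inE eqxx orbT.
have xy : x != y by apply: contraNneq ne => ->.
have xcs : x \notin cs by rewrite mem_undup.
have ycs : y \notin cs by rewrite mem_undup.
have pcs : perm_eq (undup (map fst w)) (cs ++ [:: x; y]).
  apply: uniq_perm; rewrite ?undup_uniq //.
    by rewrite cat_uniq undup_uniq /= orbF negb_or xcs ycs inE xy.
  move=> c; rewrite mem_cat /cs !mem_undup (perm_mem (perm_map fst pw)) [in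
    LHS]map_cat mem_cat orbC.
  congr (_ || _).
  by case: (d); rewrite /= !inE /=; move: (c == x) (c == y) => [] [].
rewrite (kjones_perm _ _ _ pcs) /kjones big_cat big_cons big_seq1 /= signz_opp //
  addr0.
pose L := [:: (1, 2, [:: (x, o); (y, o)], w1);
  (3, 4, strand d (x, ~~ o) (y, ~~ o), w2)]%N : cutting.
pose L' := [:: (1, 2, [::], w1); (3, 4, [::], w2)]%N : cutting.
have gL : w = glue w0 L by rewrite /glue /= cats0.
have gL' : w0 ++ w1 ++ w2 = glue w0 L' by rewrite /glue /= cats0.
have -> : (2 * size w = 2 * size (w0 ++ w1 ++ w2) + 8)%N.
  have s4 : size ([:: (x, o); (y, o)] ++ strand d (x, ~~ o) (y, ~~ o)) = 4%N.
    by case: (d).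
  by rewrite (perm_size pw) [in LHS]size_cat s4 mulnDr addnC.
rewrite exprD [in RHS]mulrA -[RHS]mulrA; congr (_ * _).
rewrite gL gL' -[LHS]mul1r -[cs in LHS]cats0; apply/esym.
apply: (@bracket_tangle _ A loop0 e cs [:: x; y] [::] (loopv A ^+ 8) 1 w0 L L') => //
  [c|c|E avE].
- by rewrite !inE => /orP[] /eqP ->.
- by rewrite !inE /= cats0 => /orP[] /eqP ->.
rewrite /inner /L /L' [flatten _]/= cats0 mul1r -catA.
have := bracket_R2 A0 loop0 o d avE ne; rewrite /R2tangle -catA => ->.
by rewrite mulrA divff ?mul1r ?expf_neq0.
Qed.

(** The cut points are parameters because the line may meet the strands in any order: in each order
    they are numbered so that the top, middle and bottom strands run between 1 and 2, 3 and 4, 5 and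
    6, as in [R3tangle]. *)
Lemma kjones_R3_at e w0 w1 w2 w3 s1 s2 s3 x y z (t m b : bool) i1 i2 i3 i4 i5 i6 :
  let w := w0 ++ s1 ++ w1 ++ s2 ++ w2 ++ s3 ++ w3 in
  let w' := w0 ++ rev s1 ++ w1 ++ rev s2 ++ w2 ++ rev s3 ++ w3 in
  let L := [:: (i1, i2, s1, w1); (i3, i4, s2, w2); (i5, i6, s3, w3)] in
  let L' := [:: (i1, i2, rev s1, w1); (i3, i4, rev s2, w2); (i5, i6, rev s3, w3)] in
  uniq w -> uniq (0%N :: cuts L) ->
  perm_eq (s1 ++ s2 ++ s3) [:: (x, true); (y, true); (x, false); (z, true);
    (y, false); (z, false)] ->
  same t (e z) = same m (e y) -> same m (e y) = same b (e x) ->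
  same_comp (inner L) (R3tangle t m b x y z) ->
  same_comp (inner L') (R3tangle (~~ t) (~~ m) (~~ b) x y z) ->
  kjones A e (undup (map fst w)) w = kjones A e (undup (map fst w')) w'.
Proof.
move=> w w' L L' Uw UL ps H1 H2 cL cL'.
have gL : w = glue w0 L by rewrite /glue /= cats0 -!catA.
have gL' : w' = glue w0 L' by rewrite /glue /= cats0 -!catA.
have ww' : perm_eq w w'.
  by rewrite /w /w'; do 3!(rewrite perm_cat2l; apply: perm_cat;
    first by rewrite perm_sym perm_rev).
have pw := perm_strands w0 w1 w2 w3 s1 s2 s3.
set s := [:: x; y; z].
have [Us sw] : uniq s /\ {in s, forall c, c \notin map fst (w0 ++ w1 ++ w2 ++ w3)}.
  exact: R3_uniq Uw ps.
set cs := [seq c <- undup (map fst w) | c \notin s].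
have pcs : perm_eq (undup (map fst w)) (cs ++ s).
  apply: uniq_perm; rewrite ?undup_uniq //.
    rewrite cat_uniq filter_uniq ?undup_uniq // Us andbT.
    by apply/hasPn => c cs'; rewrite mem_filter cs'.
  move=> c; rewrite mem_cat mem_filter.
  case cs': (c \in s) => //=; rewrite ?orbF // mem_undup.
  have : (c, true) \in s1 ++ s2 ++ s3.
    rewrite (perm_mem ps) !inE !xpair_eqE; move: cs'; rewrite !inE.
    by case/or3P=> ->; rewrite ?orbT.
  move=> cs3; have : (c, true) \in w by rewrite (perm_mem pw) mem_cat cs3.
  by move/(map_f fst).
have pcs' : perm_eq (undup (map fst w')) (cs ++ s).
  apply: perm_trans pcs; apply: perm_undup => c.
  by rewrite (perm_mem (perm_map fst ww')).
rewrite (kjones_perm _ _ _ pcs) (kjones_perm _ _ _ pcs') /kjones (perm_size ww').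
congr (_ * _); rewrite gL gL' -[LHS]mul1r -[RHS]mul1r.
apply: bracket_tangle => //.
- by move=> c; rewrite mem_filter => ->.
- by move=> c /sw; rewrite /= cats0.
move=> E avE; rewrite !mul1r.
rewrite (bracket_same _ _ _ (same_comp_catr E cL)) (bracket_same _ _ _
  (same_comp_catr E cL')).
exact: bracket_R3.
Qed.

Lemma kjones_R3 e w0 w1 w2 w3 s1 s2 s3 x y z (t m b : bool) :
  let w := w0 ++ s1 ++ w1 ++ s2 ++ w2 ++ s3 ++ w3 in
  let w' := w0 ++ rev s1 ++ w1 ++ rev s2 ++ w2 ++ rev s3 ++ w3 in
  uniq w ->
  same t (e z) = same m (e y) -> same m (e y) = same b (e x) ->
  perm_eq [:: s1; s2; s3]
      [:: strand t (x, true) (y, true);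
          strand m (x, false) (z, true);
          strand b (y, false) (z, false)] ->
  kjones A e (undup (map fst w)) w = kjones A e (undup (map fst w')) w'.
Proof.
move=> w w' Uw H1 H2 ps.
have ps6 := perm_R3 ps.
have := perm_eq3 ps.
case=> [[]|[]] [E1 E2 E3].
- apply: (@kjones_R3_at e w0 w1 w2 w3 s1 s2 s3 x y z t m b 1 2 3 4 5 6) => // f;
    by rewrite E1 E2 E3 ?rev_strand /inner /R3tangle /= cats0 !compat_cat.
- apply: (@kjones_R3_at e w0 w1 w2 w3 s1 s2 s3 x y z t m b 1 2 5 6 3 4) => // f;
    by rewrite E1 E2 E3 ?rev_strand /inner /R3tangle /= cats0 !compat_cat [X in _ &&
      X = _]andbC.
- apply: (@kjones_R3_at e w0 w1 w2 w3 s1 s2 s3 x y z t m b 3 4 1 2 5 6) => // f;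
    by rewrite E1 E2 E3 ?rev_strand /inner /R3tangle /= cats0 !compat_cat [RHS]andbCA.
- apply: (@kjones_R3_at e w0 w1 w2 w3 s1 s2 s3 x y z t m b 3 4 5 6 1 2) => // f;
    by rewrite E1 E2 E3 ?rev_strand /inner /R3tangle /= cats0 !compat_cat [LHS]andbA
      [LHS]andbC.
- apply: (@kjones_R3_at e w0 w1 w2 w3 s1 s2 s3 x y z t m b 5 6 1 2 3 4) => // f;
    by rewrite E1 E2 E3 ?rev_strand /inner /R3tangle /= cats0 !compat_cat [LHS]andbC
      -[LHS]andbA.
- apply: (@kjones_R3_at e w0 w1 w2 w3 s1 s2 s3 x y z t m b 5 6 3 4 1 2) => // f;
    by rewrite E1 E2 E3 ?rev_strand /inner /R3tangle /= cats0 !compat_cat [LHS]andbC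
      -[LHS]andbA [LHS]andbCA.
Qed.

Lemma kjones_rmove e w w' : uniq w -> uniq w' -> rmove e w w' ->
  kjones A e (undup (map fst w)) w = kjones A e (undup (map fst w')) w'.
Proof.
move=> Uw Uw' H; case: H Uw Uw'.
- by move=> w0 w1 x o _; apply: kjones_R1.
- by move=> w0 w1 w2 x y o d ne _ U; apply: kjones_R2.
- by move=> w0 w1 w2 w3 s1 s2 s3 x y z t m b H1 H2 ps U _; apply: kjones_R3 H1 H2 ps.
Qed.

End Moves.

(** * Circles of a state and ranks *)

(** A compatible colouring is constant on components, so it amounts to a free choice of colours on
    the roots counted by [n_comp]. *)
Lemma card_colourings_comp (V : finType) (r : rel V) (E : seq (V * V)) :
  connect_sym r ->
  (forall f : V -> bool, compat f E <-> forall u v, r u v -> f u = f v) ->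
  #|colourings E| = 2 ^ n_comp r predT.
Proof.
move=> rC rE; pose R := {x | x \in fingraph.roots r}.
have rP x : fingraph.root r x \in fingraph.roots r by rewrite [_ \in
  _]fingraph.roots_root.
have -> : n_comp r predT = #|{: R}|.
  by rewrite card_sig; apply: eq_card => x; rewrite !inE andbT.
rewrite -card_bool -card_ffun.
pose g (h : {ffun R -> bool}) := [ffun x => h (Sub (fingraph.root r x) (rP x))].
have gI : injective g.
  move=> h h' /ffunP hh'; apply/ffunP=> -[x xr].
  have := hh' x; rewrite !ffunE.
  suff -> : Sub (fingraph.root r x) (rP x) = exist _ x xr :> R by [].
  by apply: val_inj; apply/eqP.
rewrite -(card_imset predT gI); apply: eq_card => f.
rewrite inE; apply/idP/imsetP => [/rE cf|[h _ ->]].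
  exists [ffun x => f (val x)] => //; apply/ffunP => x; rewrite !ffunE /=.
  have /connectP[p + ->] := connect_root r x.
  elim: p x => //= y p IH x /andP[/cf -> /IH //].
apply/rE => u v uv; rewrite !ffunE; congr (h _); apply: val_inj => /=.
exact/(fingraph.rootP rC)/connect1.
Qed.

Section States.

Variables (F : fieldType) (A : F).
Hypothesis A0 : A != 0%R.
Local Open Scope ring_scope.

Lemma bracket_sum e cs E :
  bracket A e cs E = \sum_(s : (size cs).-tuple sign)
    A ^ (\sum_(x <- s) signz x) *
    loopv A ^- grank (flatten [seq smoothing (p.2 == e p.1) p.1 | p <- zip cs s] ++
      E).
Proof.
elim: cs E => [|c cs IH] E.
  rewrite (big_pred1 [tuple]) => [|s]; last by rewrite [s]tuple0; apply/esym/eqP.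
  by rewrite /= big_nil mul1r.
rewrite /= !IH !mulr_sumr.
pose h (p : sign * (size cs).-tuple sign) : (size (c :: cs)).-tuple sign :=
  [tuple of p.1 :: p.2].
have hb : {on predT, bijective h}.
  exists (fun s : (size (c :: cs)).-tuple sign => (thead s, [tuple of behead s])) =>
    [[x s] _|s _].
    by congr pair; apply: val_inj.
  by rewrite /h [in RHS](tuple_eta s); apply: val_inj.
pose t x (s : (size cs).-tuple sign) : F := A ^ (\sum_(y <- x :: s) signz y) *
    loopv A ^- grank (flatten [seq smoothing (p.2 == e p.1) p.1 | p <- zip cs s] ++
      smoothing (x == e c) c ++ E).
transitivity (\sum_x \sum_s t x s).
  rewrite (bigD1 Plus) // (bigD1 Minus) //=.
  rewrite [X in _ = _ + (_ + X)]big1 ?addr0 => [|[]//].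
  by congr (_ + _); apply: eq_bigr => s _; rewrite /t big_cons expfzDr // mulrA
    eq_sym.
rewrite pair_bigA (reindex h) //=; apply: eq_bigr => -[x s] _; rewrite /t /=.
congr (_ * _ ^- _).
by apply: grank_same => f; rewrite !compat_cat -?andbA andbCA.
Qed.

End States.

Lemma joined_sym w oriented : symmetric (@joined w oriented).
Proof.
move=> u v; rewrite /joined orbCA; congr [|| _, _ | _].
suff H x y : [exists k : 'I_(size w), exists l : 'I_(size w),
     [&& k != l, nth 0 w k == nth 0 w l &
       if oriented (nth 0 w k) then
         (x == k :> nat) && (y == l.+1 :> nat) ||
         (y == k :> nat) && (x == l.+1 :> nat)
       else
         (x == k :> nat) && (y == l :> nat) ||
         (x == k.+1 :> nat) && (y == l.+1 :> nat)]] ->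
    [exists k : 'I_(size w), exists l : 'I_(size w),
     [&& k != l, nth 0 w k == nth 0 w l &
       if oriented (nth 0 w k) then
         (y == k :> nat) && (x == l.+1 :> nat) ||
         (x == k :> nat) && (y == l.+1 :> nat)
       else
         (y == k :> nat) && (x == l :> nat) ||
         (y == k.+1 :> nat) && (x == l.+1 :> nat)]].
  by apply/idP/idP; apply: H.
case/existsP=> k /existsP[l /and3P[kl /eqP wkl H]]; move: H; case: ifP => ok H.
  by apply/existsP; exists k; apply/existsP; exists l;
    rewrite kl wkl eqxx -wkl ok orbC.
apply/existsP; exists l; apply/existsP; exists k;
  rewrite eq_sym kl wkl eqxx -wkl ok /=.
by rewrite [X in X || _]andbC [X in _ || X]andbC.
Qed.

Lemma compat_smoothingP f o c : reflect
  (forall b, if o then f (inp (c, b)) = f (outp (c, ~~ b))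
     else f (inp (c, b)) = f (inp (c, ~~ b)) /\ f (outp (c, b)) = f (outp (c, ~~ b)))
  (compat f (smoothing o c)).
Proof.
rewrite /smoothing; case: o; apply: (iffP and3P) => /= H.
- by case: H => /eqP H1 /eqP H2 _ [].
- by have := H true; have /= -> := H false; move=> /= ->; rewrite !eqxx.
- by case: H => /eqP H1 /eqP H2 _ [].
- by have [-> ->] := H true; rewrite !eqxx.
Qed.

(* Auxiliary copies of the arcs of [joined].  Attaching each endpoint side to its
   arc turns the graph of [joined] and the graph on endpoint sides into graphs
   with the same components. *)
Definition arc (k : nat) : vert := inl k.+1.

Fixpoint at_arcs (i : nat) (w : word) : edges :=
  if w is p :: w' then (arc i, inp p) :: (arc i.+1, outp p) :: at_arcs i.+1 w' else
    [::].

Fixpoint at_entries (i : nat) (w : word) (b : vert) : edges :=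
  if w is p :: w' then (inp p, arc i) :: at_entries i.+1 w' b else [:: (b, arc i)].

(** Once each entering side is tied to its arc, the edges of the line also tie that arc to the side
    left just before it, which is what [at_arcs] records. *)
Lemma compat_arcs f a i w b :
  compat f (seg a w b ++ at_entries i w b) =
  [&& f a == f (arc i), compat f (at_arcs i w) & f (arc (i + size w)) == f b].
Proof.
elim: w a i => [|p w IH] a i.
  rewrite /= addn0 !andbT.
  by move: (f a) (f b) (f (arc i)) => [] [] [].
rewrite compat_cat /= andbCA -!andbA -compat_cat IH addSnnS.
move: (compat f (at_arcs _ _)) (_ == f b) => X Y.
by move: (f a) (f (inp p)) (f (outp p)) (f (arc i)) (f (arc i.+1)) => [] [] [] [] [];
   rewrite ?andbF.
Qed.

Lemma at_arcsP f i w : reflect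
  (forall k, k < size w -> f (inp (nth (0, true) w k)) = f (arc (i + k)) /\
                           f (outp (nth (0, true) w k)) = f (arc (i + k).+1))
  (compat f (at_arcs i w)).
Proof.
elim: w i => [|p w IH] i; first by constructor.
rewrite /=; apply: (iffP and3P) => [[/eqP E1 /eqP E2 /IH H] [|k] //= kw|H].
- by rewrite addn0 E1 E2.
- by rewrite addnS -addSn; apply: H.
have [] := H 0 isT; rewrite addn0 /= => -> ->; split=> //.
by apply/IH => k kw; rewrite addSnnS; apply: (H k.+1).
Qed.

Lemma base_at_arcs i w : inl 0 \notin verts (at_arcs i w).
Proof. by elim: w i => //= p w IH i; rewrite !inE; apply: IH. Qed.

Lemma inr_at_arcs p d i w : inr (p, d) \in verts (at_arcs i w) -> p \in w.
Proof.
elim: w i => // q w IH i; rewrite [verts _]/= !inE -/(verts _).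
by case/or4P => [//|/eqP[-> _]|//|/orP[/eqP[-> _]|/IH ->]]; rewrite ?eqxx ?orbT.
Qed.

Lemma grank_at_arcs i w E : uniq w ->
  (forall p d, p \in w -> inr (p, d) \notin verts E) ->
  grank (at_arcs i w ++ E) = 2 * size w + grank E.
Proof.
elim: w i => //= p w IH i /andP[pw Uw] wE.
have pE d : inr (p, d) \notin verts (at_arcs i.+1 w ++ E).
  rewrite verts_cat mem_cat negb_or wE ?mem_head ?andbT //.
  by apply: contra pw; apply: inr_at_arcs.
rewrite grank_pendant //; last first.
  by rewrite verts_cons !inE !negb_or pE andbT; apply/andP; split=> //;
    apply/eqP => -[].
rewrite grank_pendant ?pE // IH // => [|q d qw]; first by lia.
by apply: wE; rewrite inE qw orbT.
Qed.

Lemma inl_at_entries k i w b : inl k \in verts (at_entries i w b) ->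
  (inl k == b) || (i < k).
Proof.
elim: w i => [|p w IH] i /=; rewrite !inE ?orbF.
  by case/orP=> [->//|/eqP[->]]; rewrite ltnSn orbT.
by rewrite -/(verts _) => /or3P[//|/eqP[->]|/IH/orP[->|/ltnW ->]];
  rewrite ?ltnSn ?orbT.
Qed.

Lemma grank_at_entries i w E :
  (forall k, i < k -> inl k \notin verts E) ->
  grank (at_entries i w (inl 0) ++ E) = (size w).+1 + grank E.
Proof.
elim: w i => [|p w IH] i iE /=.
  by rewrite grank_pendant // iE.
rewrite grank_pendant //; last first.
  rewrite verts_cat mem_cat negb_or iE // andbT.
  by apply/negP => /inl_at_entries /orP[//|]; rewrite ltnn.
by rewrite IH // => k ik; apply: iE; apply: ltnW.
Qed.

(** Both graphs are enlarged by pendant vertices until they have the same components: the endpoint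
    sides and the base point are added to the graph of [joined], the arcs to the graph on endpoint
    sides. *)
Lemma circles_grank (w : word) oriented : gauss_wf w ->
  circles (map fst w) oriented +
  grank (flatten [seq smoothing (oriented c) c | c <- undup (map fst w)] ++
         seg (inl 0) w (inl 0)) = (2 * size w).+1.
Proof.
case/andP=> Uw /allP Pw; set W := map fst w; set sm := flatten _.
have sW : size W = size w by rewrite size_map.
pose J := [seq e <- [seq (u, v) | u <- enum 'I_(size W).+1, v <- enum 'I_(size W).+1]
  |
  joined oriented e.1 e.2].
have JP (f : 'I_(size W).+1 -> bool) :
    compat f J <-> forall u v, joined oriented u v -> f u = f v.
  split=> [/allP H u v uv|H].
    apply/eqP/(H (u, v)); rewrite mem_filter uv; apply/allpairsP.
    by exists (u, v); rewrite !mem_enum.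
  by apply/allP => -[u v]; rewrite mem_filter /= => /andP[/H -> _].
have Jc : #|colourings J| = 2 ^ circles W oriented.
  by apply: card_colourings_comp => //; exact/sym_connect_sym/joined_sym.
have := card_colourings J; rewrite Jc -expnD card_ord => /eqP.
rewrite eqn_exp2l // => /eqP cJ.
pose varc (u : 'I_(size W).+1) := arc u.
pose J' := [seq (varc e.1, varc e.2) | e <- J].
have gJ' : grank J' = grank J.
  by apply: grank_map => u v _ _ /= [] /ord_inj.
have {}cJ : circles W oriented + grank J' = (size w).+1 by rewrite gJ' cJ sW.
have J'v v : v \in verts J' -> exists2 k, k <= size w & v = arc k.
  case/flattenP=> _ /mapP[_ /mapP[[x y] _ ->] ->].
  rewrite !inE -sW => /orP[] /eqP ->; first by exists x; rewrite // -ltnS ltn_ord.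
  by exists y; rewrite // -ltnS ltn_ord.
have J'inr p d : inr (p, d) \notin verts J' by apply/negP => /J'v[].
have J'0 : inl 0 \notin verts J' by apply/negP => /J'v[].
have smv v : v \in verts sm -> exists2 p, p.1 \in W & exists d, v = inr (p, d).
  case/flattenP=> _ /mapP[x + ->]; case/flattenP=> _ /mapP[c cW ->] xc vx.
  have : v \in ports c.
    apply: verts_smoothing (oriented c) _ _ _; apply/flattenP; exists [:: x.1;
      x.2] => //.
    exact: map_f.
  rewrite mem_undup in cW.
  by rewrite !inE => /or4P[] /eqP ->; [exists (c, true) | exists (c, true) |
     exists (c, false) | exists (c, false)] => //; eexists.
set E := sm ++ seg _ _ _.
have arcE k : arc k \notin verts E.
  rewrite /E verts_cat mem_cat inl_verts_seg /= orbF; apply/negP.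
  by move=> /smv[p _ [d]].
have gE : grank (at_entries 0 w (inl 0) ++ E) = (size w).+1 + grank E.
  by apply: grank_at_entries => -[//|k] _; apply: arcE.
have gJ : grank ((arc 0, inl 0) :: at_arcs 0 w ++ J') = (2 * size w + grank J').+1.
  rewrite grank_pendant //; last first.
    by rewrite verts_cat mem_cat negb_or base_at_arcs.
  by rewrite grank_at_arcs.
(* With [n] endpoints, equal ranks mean [2n + grank J' + 1 = n + 1 + grank E]; since the circles and
   [grank J'] add up to [n + 1], the circles and [grank E] add up to [2n + 1]. *)
suff same : same_comp ((arc 0, inl 0) :: at_arcs 0 w ++ J') (at_entries 0 w (inl 0)
  ++ E).
  by move: (grank_same same); rewrite gJ gE; lia.
move=> f; rewrite [LHS]/= /E !compat_cat [RHS]andbCA [X in _ = _ && X]andbC.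
rewrite -[X in _ = _ && X]compat_cat compat_arcs add0n.
rewrite [f (arc 0) == _]eq_sym.
case f0 : (f (inl 0) == f (arc 0)); rewrite /= ?andbF //.
case: (boolP (compat f (at_arcs 0 w))) => [/at_arcsP fa|_]; rewrite ?andbF //=.
have fin k : k < size w -> f (inp (nth (0, true) w k)) = f (arc k) by case/fa.
have fout k : k < size w -> f (outp (nth (0, true) w k)) = f (arc k.+1) by case/fa.
have nW k : k < size w -> nth 0 W k = (nth (0, true) w k).1.
  by move=> kw; rewrite (nth_map (0, true)).
have csm : compat f sm <-> forall c, c \in W -> compat f (smoothing (oriented c) c).
  split=> [/allP H c cW|H].
    apply/allP => x xc; apply: H; apply/flattenP;
      exists (smoothing (oriented c) c) => //.
    by apply: map_f; rewrite mem_undup.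
  apply/allP => x /flattenP[_ /mapP[c + ->]]; rewrite mem_undup => /H /allP; exact.
rewrite compat_map; apply/idP/andP.
  move/(JP (f \o varc)) => H.
  have Hn a b (ha : a < (size W).+1) (hb : b < (size W).+1) :
      joined oriented (Ordinal ha) (Ordinal hb) -> f (arc a) = f (arc b).
    exact: H.
  split; last first.
    (* The base point plays the role of the closing edge between the arcs 0 and [size w]. *)
    rewrite (eqP f0); apply/eqP; have nW1 : size w < (size W).+1 by rewrite sW.
    apply: (Hn _ _ nW1 (ltn0Sn _)); apply/or3P; apply: Or32.
    by rewrite /= sW eqxx.
  apply/csm => c cW.
  have cw o : (c, o) \in w.
    case/mapP: cW => -[d u] dw /= ->; case: (eqVneq o u) => [->//|].
    have := Pw _ dw; by case: (o) (u) => [] [].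
  have kw o : index (c, o) w < size W by rewrite sW index_mem.
  have Hk o : [/\ f (inp (c, o)) = f (arc (index (c, o) w)),
      f (outp (c, o)) = f (arc (index (c, o) w).+1) &
      nth 0 W (index (c, o) w) = c].
    have := kw o; rewrite sW => kw'.
    by rewrite -(fin _ kw') -(fout _ kw') nW // nth_index.
  apply/compat_smoothingP => o.
  pose k := Ordinal (kw o); pose l := Ordinal (kw (~~ o)).
  have kl : k != l.
    apply/eqP => /(congr1 val) /= E1; have := nth_index (0, true) (cw o).
    by rewrite E1 nth_index // => -[]; case: (o).
  have j (u v : 'I_(size W).+1) : (if oriented c then
         (u == k :> nat) && (v == l.+1 :> nat) ||
         (v == k :> nat) && (u == l.+1 :> nat)
       else
         (u == k :> nat) && (v == l :> nat) ||
         (u == k.+1 :> nat) && (v == l.+1 :> nat)) -> joined oriented u v.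
    move=> cond; rewrite /joined; apply/or3P; apply: Or33.
    apply/existsP; exists k; apply/existsP; exists l; rewrite kl /=.
    by have [_ _ ->] := Hk o; have [_ _ ->] := Hk (~~ o); rewrite eqxx.
  have [-> -> _] := Hk o; have [-> -> _] := Hk (~~ o).
  have kS b : (index (c, b) w).+1 < (size W).+1 by apply: kw.
  have k0 b : index (c, b) w < (size W).+1 by apply/ltnW/kw.
  case: ifP j => oc j.
    apply: (Hn _ _ (k0 o) (kS (~~ o))); apply: j; by rewrite /= !eqxx.
  split.
    by apply: (Hn _ _ (k0 o) (k0 (~~ o))); apply: j; rewrite /= !eqxx.
  by apply: (Hn _ _ (kS o) (kS (~~ o))); apply: j; rewrite /= !eqxx orbT.
case=> /csm fsm /eqP fn.
apply/(JP (f \o varc)) => u v /or3P[].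
- by case/andP=> /eqP /= u0 /eqP vn; rewrite /varc u0 vn sW fn (eqP f0).
- by case/andP=> /eqP /= v0 /eqP un; rewrite /varc v0 un sW fn (eqP f0).
case/existsP=> k /existsP[l /and3P[kl /eqP wkl H]] /=.
have kw : k < size w by rewrite -sW.
have lw : l < size w by rewrite -sW.
set c := nth 0 W k in wkl H.
have cW : c \in W by apply: mem_nth.
move/compat_smoothingP: (fsm c cW) => sc.
have [o ok] : exists o, nth (0, true) w k = (c, o).
  by exists (nth (0, true) w k).2; rewrite /c nW // -surjective_pairing.
have ol : nth (0, true) w l = (c, ~~ o).
  have : nth (0, true) w l != (c, o).
    rewrite -ok nth_uniq //; apply: contra kl => /eqP lk.
    by apply/eqP/val_inj.
  rewrite wkl nW // [nth _ w l]surjective_pairing /=.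
  by move: (nth _ w l).2 => o'; rewrite xpair_eqE eqxx /=;
    case: o o' {ok sc} => [] [].
have := sc o; rewrite -ok -ol !fin ?fout //.
have := sc (~~ o); rewrite negbK -ok -ol !fin ?fout //.
rewrite /varc; move: H; case: ifP => _ /orP[] /andP[/eqP -> /eqP ->] //.
all: by move=> _ [].
Qed.

Lemma circles_gt0 w oriented : 0 < circles w oriented.
Proof.
rewrite /circles /n_comp_mem; apply/card_gt0P.
exists (fingraph.root (joined oriented) ord0); rewrite !inE /= andbT.
exact: roots_root (sym_connect_sym (@joined_sym _ _)) _.
Qed.

(** * The Jones polynomial as a normalised bracket *)

Section Jones.
Local Open Scope ring_scope.

Lemma loopvV (F : fieldType) (x : F) : x != 0 -> loopv x^-1 = - x ^- 2 * (1 + x ^+ 4).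
Proof. by move=> x0; rewrite /loopv exprVn invrK; field. Qed.

Lemma kauffA_neq0 : kauffA != 0.
Proof. by rewrite invr_eq0 tofrac_eq0 polyX_eq0. Qed.

Lemma loopv_neq0 : loopv kauffA != 0.
Proof.
have X0 : tofrac ('X : {poly int}) != 0 by rewrite tofrac_eq0 polyX_eq0.
rewrite /kauffA (loopvV X0) mulf_eq0 negb_or oppr_eq0 invr_eq0.
apply/andP; split; first exact: expf_neq0.
rewrite -tofrac1 -tofracXn -tofracD tofrac_eq0.
apply/eqP => /(congr1 (fun p : {poly int} => p.[0])).
by rewrite !hornerE.
Qed.

Lemma smoothing_states e cs (s : seq sign) : uniq cs -> size s = size cs ->
  [seq smoothing (p.2 == e p.1) p.1 | p <- zip cs s] =
  [seq smoothing (nth Plus s (index c cs) == e c) c | c <- cs].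
Proof.
move=> Uc sc; apply: (@eq_from_nth _ [::]) => [|i].
  by rewrite !size_map size_zip sc minnn.
rewrite size_map size_zip sc minnn => ic.
rewrite (nth_map (0%N, Plus)) ?size_zip ?sc ?minnn // nth_zip //.
by rewrite (nth_map 0%N) // index_uniq.
Qed.

Lemma jones_kjones (G : gauss) :
  jones G = kjones kauffA (gsign G) (undup (gchords G)) (gword G).
Proof.
rewrite /jones /kjones -mulrA; congr (_ * _).
rewrite (bracket_sum kauffA_neq0) mulr_sumr; apply: eq_bigr => s _.
rewrite mulrCA; congr (_ * _); rewrite -/(loopv _).
rewrite smoothing_states ?undup_uniq ?size_tuple //.
have := circles_grank (fun c => marker G s c == gsign G c) (gwordP G).
rewrite -/(gchords G) -/(state_circles G s).
rewrite -/(marker G s _).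
set r := grank _; set n := state_circles G s => nr.
(* Positivity makes the predecessor in the exponent a true subtraction of 1. *)
have n0 : (0 < n)%N by exact: circles_gt0.
have -> : (2 * size (gword G) = n.-1 + r)%N by lia.
by rewrite exprD mulfK // expf_neq0 // loopv_neq0.
Qed.

End Jones.

(** * Reversing arrows *)

Notation word_jones e w := (kjones kauffA e (undup (map fst w)) w).

Lemma cdiag_eq (L : Type) (P Q : cdiag L) :
  cword P = cword Q -> clab P = clab Q -> P = Q.
Proof.
case: P Q => w l wP [w' l' wP'] /= ww ll.
by case: w' / ww wP' => wP'; rewrite ll (bool_irrelevance wP wP').
Qed.

Lemma jones_cdE (e : nat -> sign) (w : word) (wP : gauss_wf w) (P : cdiag sign) :
  cword P = map fst w -> clab P = e -> jones_cd P = word_jones e w.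
Proof.
move=> Pw Pe; rewrite -[RHS](jones_kjones (Gauss e wP)).
by apply/esym/jones_choice/cdiag_eq.
Qed.

(** Words that differ only in their arrows have the same signed chord diagram, which is all that the
    state sum reads. *)
Lemma word_jones_arrows e (w w' : word) : gauss_wf w -> gauss_wf w' ->
  map fst w = map fst w' -> word_jones e w = word_jones e w'.
Proof.
move=> wP wP' ww'; pose P := map_pr (Gauss e wP).
by rewrite -(@jones_cdE e w wP P) // -(@jones_cdE e w' wP' P).
Qed.

Lemma word_jones_rename (e e' : nat -> sign) f (w : word) :
  {in map fst w &, injective f} -> {in map fst w, forall c, e' (f c) = e c} ->
  word_jones e' (rename_word f w) = word_jones e w.
Proof.
move=> fI fe; set cs := undup (map fst w).
have csw c : c \in cs -> c \in map fst w by rewrite mem_undup.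
have wf : map fst (rename_word f w) = map f (map fst w) by rewrite -!map_comp.
have pcs : perm_eq (undup (map fst (rename_word f w))) (map f cs).
  apply: uniq_perm; rewrite ?undup_uniq //.
    rewrite map_inj_in_uniq ?undup_uniq // => c d /csw cw /csw dw; exact: fI.
  move=> c; rewrite mem_undup wf; apply/mapP/mapP => -[d dw ->]; exists d => //.
    by rewrite mem_undup.
  exact: csw.
rewrite (kjones_perm _ _ _ pcs) /kjones size_map big_map.
have -> : (\sum_(c <- cs) signz (e' (f c)) = \sum_(c <- cs) signz (e c))%R.
  by apply: eq_big_seq => c /csw /fe ->.
congr (_ * _)%R.
have -> : seg (inl 0) (rename_word f w) (inl 0) = rename_edges f (seg (inl 0) w (inl
  0)).
  by rewrite rename_seg.
apply: bracket_rename => [u v|c /csw]; last exact: fe.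
have name x : x \in verts (seg (inl 0) w (inl 0)) ++ flatten (map ports cs) ->
    x = inl 0 \/ exists2 c, c \in map fst w & exists od, x = inr (c, od.1, od.2).
  rewrite mem_cat => /orP[|/flattenP[_ /mapP[c ccs ->]]].
    case: x => [k|[[c o] d]].
      by rewrite inl_verts_seg orbb => /eqP; left.
    by move/inr_verts_seg => cw; right; exists c; [apply: map_f cw|exists (o, d)].
  move=> xc; right; exists c; first exact: csw.
  by move: xc; rewrite !inE => /or4P[] /eqP ->;
    [exists (true, false)|exists (true, true)|exists (false, false)|exists (false,
      true)].
move=> /name[->|[c cw [[o d] ->]]] /name[->|[c' cw' [[o' d'] ->]]] //= [].
by move/fI => -> // -> ->.
Qed.

Definition forward (w : word) (c : nat) : bool := index (c, true) w < index (c,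
  false) w.

(** The direction of a chord depends only on the relative order of its own two endpoints. *)
Lemma forward_filter c w : forward [seq p <- w | p.1 == c] c = forward w c.
Proof.
rewrite /forward; elim: w => //= -[d o] w IH /=.
case: (eqVneq d c) => [->|dc] /=; rewrite !xpair_eqE.
  by rewrite eqxx /=; case: o.
by rewrite (negbTE dc) /= ltnS.
Qed.

Lemma filter_notin c (w : word) : c \notin map fst w -> [seq p <- w | p.1 == c] =
  [::].
Proof.
move=> cw; apply/eqP; rewrite -(negbK (_ == _)) -has_filter; apply/hasPn => p pw.
by apply: contraNneq cw => <-; apply: map_f.
Qed.

Definition flip (g : nat -> bool) (w : word) : word := [seq (p.1, p.2 (+) g p.1) | p
  <- w].

Definition flip_sign (b : bool) (s : sign) := if b then tau1 s else s.

Lemma flip_wf g w : gauss_wf w -> gauss_wf (flip g w).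
Proof.
have fI : injective (fun p : nat * bool => (p.1, p.2 (+) g p.1)).
  by move=> [c o] [d o'] /= [->] /addIb ->.
case/andP=> Uw /allP Pw; apply/andP; split; first by rewrite map_inj_uniq.
apply/allP => _ /mapP[[c o] /Pw cw ->] /=; rewrite -addNb.
by apply: (map_f (fun p => (p.1, p.2 (+) g p.1))) cw.
Qed.

Lemma map_fst_flip g w : map fst (flip g w) = map fst w.
Proof. by rewrite -map_comp. Qed.

(** Changing all signs keeps opposite signs opposite and negates every [same], so the equations of a
    third move still hold. *)
Lemma rmove_tau1 e w w' : rmove e w w' -> rmove (tau1 \o e) w w'.
Proof.
have sameN o s : same o (tau1 s) = ~~ same o s by case: o; case: s.
case=> [w0 w1 x o|w0 w1 w2 x y o d ne|w0 w1 w2 w3 s1 s2 s3 x y z t m b H1 H2 ps].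
- exact: R1.
- by apply: R2; move: ne; rewrite /=; case: (e x); case: (e y).
- by apply: R3 ps; rewrite /= !sameN ?H1 ?H2.
Qed.

Lemma rmove_ext e e' w w' : uniq w' -> {in map fst w', e =1 e'} ->
  rmove e w w' -> rmove e' w w'.
Proof.
move=> Uw' ee' H; case: H Uw' ee' => [w0 w1 x o|w0 w1 w2 x y o d ne|w0 w1 w2 w3 s1 s2
  s3 x y z t m b H1 H2 ps] Uw' ee'.
- exact: R1.
- by apply: R2; rewrite -!ee' // !map_cat !mem_cat /= !in_cons eqxx ?orbT.
have cw c o : (c, o) \in s1 ++ s2 ++ s3 -> e c = e' c.
  move=> cs; apply: ee'; rewrite !map_cat !mem_cat !map_rev !mem_rev.
  have := map_f fst cs; rewrite !map_cat !mem_cat.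
  by case/or3P => ->; rewrite ?orbT.
have ps6 := perm_mem (perm_R3 ps).
have ex := cw x true; have ey := cw y true; have ez := cw z true.
by apply: R3 ps; rewrite -?ex -?ey -?ez // ps6 !inE eqxx ?orbT.
Qed.

Lemma eq_forward w w' c :
  [seq p <- w | p.1 == c] = [seq p <- w' | p.1 == c] -> forward w c = forward w' c.
Proof. by move=> H; rewrite -(forward_filter c w) H forward_filter. Qed.

Lemma forward2 x o : forward [:: (x, o); (x, ~~ o)] x = o.
Proof. by case: o; rewrite /forward /= !xpair_eqE !eqxx. Qed.

Lemma filter_strandN c d (u v : nat * bool) : u.1 != v.1 ->
  [seq p <- strand (~~ d) u v | p.1 == c] = [seq p <- strand d u v | p.1 == c].
Proof.
move=> uv; have : ~~ ((u.1 == c) && (v.1 == c)).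
  by apply: contra uv => /andP[/eqP -> /eqP ->].
by case: d => /=; case: eqP; case: eqP.
Qed.

Lemma forward_strands (w0 w1 w2 w3 s1 s2 s3 : word) c :
  c \notin map fst (w0 ++ w1 ++ w2 ++ w3) ->
  forward (w0 ++ s1 ++ w1 ++ s2 ++ w2 ++ s3 ++ w3) c = forward (s1 ++ s2 ++ s3) c.
Proof.
rewrite !map_cat !mem_cat !negb_or => /and4P[c0 c1 c2 c3].
by apply: eq_forward; rewrite !filter_cat !(filter_notin c0, filter_notin c1,
  filter_notin c2, filter_notin c3) cats0.
Qed.

(** The first two moves insert endpoints of other chords only. The third exchanges adjacent
    endpoints of distinct chords, so no chord has its own endpoints reordered. *)
Lemma rmove_forward e w w' : uniq w -> uniq w' -> rmove e w w' -> {in map fst w,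
  forward w =1 forward w'}.
Proof.
move=> Uw Uw' H; case: H Uw Uw' => [w0 w1 x o|w0 w1 w2 x y o d ne|w0 w1 w2 w3 s1 s2
  s3 x y z t m b H1 H2 ps] Uw Uw' c cw;
  apply: eq_forward.
- have cx : (x == c) = false.
    apply/negbTE; apply: contraTneq cw => <-.
    apply: (chord_notin (s := [:: (x, o); (x, ~~ o)]) Uw');
      first by rewrite perm_catCA.
    by move=> o'; rewrite !inE !xpair_eqE eqxx /=; case: (o); case: o'.
  by rewrite !filter_cat /= cx.
- have nc v : v \in [:: x; y] -> (v == c) = false.
    by move=> vxy; apply/negbTE; apply: contraTneq cw => <-; apply: (R2_notin Uw').
  have cx := nc x (mem_head _ _); have cy : (y == c) = false.
    by apply: nc; rewrite !inE eqxx orbT.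
  by rewrite !filter_cat; case: (d); rewrite /= cx cy.
have [+ _] := R3_uniq Uw (perm_R3 ps); rewrite /= !inE negb_or -andbA andbT =>
  /and3P[xy xz yz].
have fr : forall s, s \in [:: s1; s2; s3] ->
    [seq p <- rev s | p.1 == c] = [seq p <- s | p.1 == c].
  move=> s; rewrite (perm_mem ps) !inE => /or3P[] /eqP ->;
  by rewrite rev_strand filter_strandN.
by rewrite !filter_cat !fr // !inE eqxx ?orbT.
Qed.

Lemma flip_cat g w w' : flip g (w ++ w') = flip g w ++ flip g w'.
Proof. exact: map_cat. Qed.

Lemma flip_rev g w : flip g (rev w) = rev (flip g w).
Proof. exact: map_rev. Qed.

Lemma flip_strand g d (u v : nat * bool) :
  flip g (strand d u v) = strand d (u.1, u.2 (+) g u.1) (v.1, v.2 (+) g v.1).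
Proof. by case: d. Qed.

(** Used with [g] marking the backward chords: once their arrows are reversed, the strands in the
    order of the line are the top, middle and bottom ones. Exchanging over and under changes the
    sign of the determinant that defines a crossing sign, whence [flip_sign]. *)
Lemma R3_flip e (g : nat -> bool) w0 w1 w2 w3 s1 s2 s3 x y z t m b :
  let e' c := flip_sign (g c) (e c) in
  same t (e' z) = same m (e' y) -> same m (e' y) = same b (e' x) ->
  flip g s1 = strand t (x, true) (y, true) ->
  flip g s2 = strand m (x, false) (z, true) ->
  flip g s3 = strand b (y, false) (z, false) ->
  rmove e' (flip g (w0 ++ s1 ++ w1 ++ s2 ++ w2 ++ s3 ++ w3))
    (flip g (w0 ++ rev s1 ++ w1 ++ rev s2 ++ w2 ++ rev s3 ++ w3)).
Proof.
move=> e' H1 H2 E1 E2 E3; rewrite !flip_cat !flip_rev.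
by apply: R3 H1 H2 _; rewrite E1 E2 E3.
Qed.

(* In the third move, the six cases are the orders in which the line can meet the
   top, middle and bottom strands. *)
Lemma rmove_flip e w w' : uniq w -> uniq w' -> rmove e w w' ->
  rmove (fun c => flip_sign (~~ forward w' c) (e c))
    (flip (fun c => ~~ forward w' c) w) (flip (fun c => ~~ forward w' c) w').
Proof.
move=> Uw Uw' H; case: H Uw Uw' => [w0 w1 x o|w0 w1 w2 x y o d ne|w0 w1 w2 w3 s1 s2
  s3 x y z t m b H1 H2 ps] Uw Uw'.
- by rewrite !flip_cat [flip _ [:: _; _]]/= addNb; apply: R1.
- have nx : x \notin map fst (w0 ++ w1 ++ w2).
    by apply: (R2_notin Uw'); rewrite mem_head.
  have ny : y \notin map fst (w0 ++ w1 ++ w2).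
    by apply: (R2_notin Uw'); rewrite !inE eqxx orbT.
  set v' := w0 ++ _ ++ _ in Uw' *.
  have xy : (x == y) = false by apply/negbTE; apply: contraNneq ne => ->.
  have yx : (y == x) = false by rewrite eq_sym.
  (* Both chords start on the same strand, so their directions agree. Either both or neither are
     reversed, and their signs stay opposite. *)
  have fx : forward v' x = o.
    move: nx; rewrite -forward_filter /v' !map_cat !mem_cat !negb_or => /and3P[n0 n1
      n2].
    rewrite !filter_cat !(filter_notin n0, filter_notin n1, filter_notin n2) cats0.
    by case: (d); rewrite /= !eqxx yx forward2.
  have fy : forward v' y = o.
    move: ny; rewrite -forward_filter /v' !map_cat !mem_cat !negb_or => /and3P[n0 n1
      n2].
    rewrite !filter_cat !(filter_notin n0, filter_notin n1, filter_notin n2) cats0.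
    by case: (d); rewrite /= !eqxx xy forward2.
  rewrite {2}/v' !flip_cat flip_strand [flip _ [:: _; _]]/= fx fy !addNb.
  by apply: R2; rewrite fx fy; move: ne; case: (e x); case: (e y); case: (o).
set v' := w0 ++ _ ++ _ in Uw' *.
have ps6 := perm_R3 ps.
have [+ sw] := R3_uniq Uw ps6; rewrite /= !inE negb_or -andbA andbT => /and3P[xy xz
  yz].
have fE c : c \in [:: x; y; z] -> forward v' c = forward (rev s1 ++ rev s2 ++ rev s3)
  c.
  by move=> cs; rewrite /v' forward_strands // sw.
have [fx fy fz] : [/\ forward v' x = forward (rev s1 ++ rev s2 ++ rev s3) x,
    forward v' y = forward (rev s1 ++ rev s2 ++ rev s3) y &
    forward v' z = forward (rev s1 ++ rev s2 ++ rev s3) z].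
  by split; apply: fE; rewrite !inE eqxx ?orbT.
have neq := (negbTE xy, negbTE xz, negbTE yz, xpair_eqE, eqxx,
  eq_sym y x, eq_sym z x, eq_sym z y).
(* The crossings passed to [R3_flip] are, in this order, those of the first and second, first and
   third, second and third strands met. A flag is negated when this renaming lists the two crossings
   of its strand in the other order. *)
case: (perm_eq3 ps) => [[]|[]] [E1 E2 E3]; rewrite E1 E2 E3 !rev_strand in fx fy fz.
- have [Fx Fy Fz] : [/\ forward v' x = true, forward v' y = true & forward v' z =
  true].
    by rewrite fx fy fz; case: (t) (m) (b) => [] [] []; rewrite /forward /= !neq.
  apply: (@R3_flip _ _ _ _ _ _ _ _ _ x y z t m b);
    rewrite ?E1 ?E2 ?E3 ?flip_strand /= ?Fx ?Fy ?Fz.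
  1,2: by move: H1 H2; case: (e x) (e y) (e z) (t) (m) (b) => [] [] [] [] [] [].
  1-3: by case: (t); case: (m); case: (b).
- have [Fx Fy Fz] : [/\ forward v' x = true, forward v' y = true & forward v' z =
  false].
    by rewrite fx fy fz; case: (t) (m) (b) => [] [] []; rewrite /forward /= !neq.
  apply: (@R3_flip _ _ _ _ _ _ _ _ _ y x z (~~ t) b m);
    rewrite ?E1 ?E2 ?E3 ?flip_strand /= ?Fx ?Fy ?Fz.
  1,2: by move: H1 H2; case: (e x) (e y) (e z) (t) (m) (b) => [] [] [] [] [] [].
  1-3: by case: (t); case: (m); case: (b).
- have [Fx Fy Fz] : [/\ forward v' x = false, forward v' y = true & forward v' z =
  true].
    by rewrite fx fy fz; case: (t) (m) (b) => [] [] []; rewrite /forward /= !neq.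
  apply: (@R3_flip _ _ _ _ _ _ _ _ _ x z y m t (~~ b));
    rewrite ?E1 ?E2 ?E3 ?flip_strand /= ?Fx ?Fy ?Fz.
  1,2: by move: H1 H2; case: (e x) (e y) (e z) (t) (m) (b) => [] [] [] [] [] [].
  1-3: by case: (t); case: (m); case: (b).
- have [Fx Fy Fz] : [/\ forward v' x = false, forward v' y = false & forward v' z =
  true].
    by rewrite fx fy fz; case: (t) (m) (b) => [] [] []; rewrite /forward /= !neq.
  apply: (@R3_flip _ _ _ _ _ _ _ _ _ z x y (~~ m) (~~ b) t);
    rewrite ?E1 ?E2 ?E3 ?flip_strand /= ?Fx ?Fy ?Fz.
  1,2: by move: H1 H2; case: (e x) (e y) (e z) (t) (m) (b) => [] [] [] [] [] [].
  1-3: by case: (t); case: (m); case: (b).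
- have [Fx Fy Fz] : [/\ forward v' x = true, forward v' y = false & forward v' z =
  false].
    by rewrite fx fy fz; case: (t) (m) (b) => [] [] []; rewrite /forward /= !neq.
  apply: (@R3_flip _ _ _ _ _ _ _ _ _ y z x b (~~ t) (~~ m));
    rewrite ?E1 ?E2 ?E3 ?flip_strand /= ?Fx ?Fy ?Fz.
  1,2: by move: H1 H2; case: (e x) (e y) (e z) (t) (m) (b) => [] [] [] [] [] [].
  1-3: by case: (t); case: (m); case: (b).
- have [Fx Fy Fz] : [/\ forward v' x = false, forward v' y = false & forward v' z =
  false].
    by rewrite fx fy fz; case: (t) (m) (b) => [] [] []; rewrite /forward /= !neq.
  apply: (@R3_flip _ _ _ _ _ _ _ _ _ z y x (~~ b) (~~ m) (~~ t));
    rewrite ?E1 ?E2 ?E3 ?flip_strand /= ?Fx ?Fy ?Fz.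
  1,2: by move: H1 H2; case: (e x) (e y) (e z) (t) (m) (b) => [] [] [] [] [] [].
  1-3: by case: (t); case: (m); case: (b).
Qed.

(** * Invariance of the four polynomials *)

Definition ip_sign (e : nat -> sign) (w : word) (c : nat) := flip_sign (~~ forward w
  c) (e c).

(** In both words the arrows that are backward in [w'] are reversed, which does not affect the
    polynomial. The results are related by a move for the signs [ip_sign e w'], which agree with
    [ip_sign e w] on the chords of [w]. Taking [h] to be the identity or [tau1] treats [i] and [i_a]
    together. *)
Lemma word_jones_ip_rmove (h : sign -> sign) e w w' : h =1 id \/ h =1 tau1 ->
  gauss_wf w -> gauss_wf w' -> rmove e w w' ->
  word_jones (h \o ip_sign e w) w = word_jones (h \o ip_sign e w') w'.
Proof.
move=> hE wP wP' ww'; have /andP[Uw _] := wP; have /andP[Uw' _] := wP'.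
pose g c := ~~ forward w' c.
have /andP[Ufw _] := flip_wf g wP; have /andP[Ufw' _] := flip_wf g wP'.
rewrite (word_jones_arrows _ wP (flip_wf g wP)) //; last by rewrite map_fst_flip.
rewrite (word_jones_arrows _ wP' (flip_wf g wP')) //; last by rewrite map_fst_flip.
transitivity (word_jones (h \o ip_sign e w') (flip g w)).
  rewrite map_fst_flip; apply: kjones_ext => c; rewrite mem_undup => cw.
  by rewrite /= /ip_sign (rmove_forward Uw Uw' ww').
apply: (kjones_rmove kauffA_neq0 loopv_neq0 Ufw Ufw').
have H := rmove_flip Uw Uw' ww'.
case: hE => hE.
  by apply: rmove_ext Ufw' _ H => c _; rewrite /= hE.
by apply: rmove_ext Ufw' _ (rmove_tau1 H) => c _; rewrite /= hE.
Qed.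

Lemma word_jones_rmove (h : sign -> sign) e w w' : h =1 id \/ h =1 tau1 ->
  gauss_wf w -> gauss_wf w' -> rmove e w w' ->
  word_jones (h \o e) w = word_jones (h \o e) w'.
Proof.
move=> hE /andP[Uw _] /andP[Uw' _] H.
apply: (kjones_rmove kauffA_neq0 loopv_neq0 Uw Uw').
case: hE => hE.
  by apply: rmove_ext Uw' _ H => c _; rewrite /= hE.
by apply: rmove_ext Uw' _ (rmove_tau1 H) => c _; rewrite /= hE.
Qed.

Lemma forward_rename (f : nat -> nat) (w : word) c : {in map fst w &, injective f} ->
  c \in map fst w -> forward (rename_word f w) (f c) = forward w c.
Proof.
move=> fI cw; have ix o : index (f c, o) (rename_word f w) = index (c, o) w.
  have : {in map fst w, forall d, (f d == f c) = (d == c)}.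
    by move=> d dw; apply/eqP/eqP => [/fI -> //|->].
  elim: w {fI cw} => //= -[d u] w IH H; rewrite !xpair_eqE /= H ?mem_head //.
  by rewrite IH // => x xw; apply: H; rewrite inE xw orbT.
by rewrite /forward !ix.
Qed.

Lemma lvk_word_jones (h : sign -> sign) : h =1 id \/ h =1 tau1 ->
  forall D D', lvk_equiv D D' ->
  word_jones (h \o gsign D) (gword D) = word_jones (h \o gsign D') (gword D') /\
  word_jones (h \o ip_sign (gsign D) (gword D)) (gword D) =
  word_jones (h \o ip_sign (gsign D') (gword D')) (gword D').
Proof.
move=> hE D D'; elim=> {D D'} [G H [f [fI -> fs]]|G H GH m|G H _ [-> ->]|G H K _ [->
  ->] _ [-> ->]] //.
  rewrite -/(rename_word f _); split; symmetry; apply: word_jones_rename => // c cG.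
    by rewrite /= fs.
  by rewrite /= /ip_sign forward_rename ?fs.
have hm := word_jones_rmove hE (gwordP G) (gwordP H) m.
have him := word_jones_ip_rmove hE (gwordP G) (gwordP H) m.
by rewrite hm him; split; apply: kjones_ext => c _; rewrite /= /ip_sign GH.
Qed.

Lemma jones_cd_word (G : gauss) (P : cdiag sign) (e : nat -> sign) :
  cword P = gchords G -> clab P =1 e -> jones_cd P = word_jones e (gword G).
Proof.
move=> PG Pe; rewrite (jones_cdE (gwordP G) PG (erefl _)).
by apply: kjones_ext => c _; apply: Pe.
Qed.

Lemma clab_ip (G : gauss) :
  clab (map_i (map_p G)) =1 ip_sign (gsign G) (gword G).
Proof.
move=> c; rewrite /= /ip_sign /forward -/(arrow_forward G c).
by case: (gsign G c); case: (arrow_forward G c).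
Qed.

Lemma jones_cd_ip (G : gauss) :
  jones_cd (map_i (map_p G)) = word_jones (ip_sign (gsign G) (gword G)) (gword G).
Proof. exact/jones_cd_word/clab_ip. Qed.

Lemma clab_iap (G : gauss) :
  clab (map_ia (map_p G)) =1 tau1 \o ip_sign (gsign G) (gword G).
Proof. by move=> c; rewrite /= -clab_ip. Qed.

(** * Examples *)

Lemma forward_chord_wf : gauss_wf [:: (0, true); (0, false)]. Proof. by []. Qed.
Lemma backward_chord_wf : gauss_wf [:: (0, false); (0, true)]. Proof. by []. Qed.

Lemma not_same_map (F1 F2 : gauss -> cdiag sign) (G : gauss) :
  cword (F1 G) = [:: 0; 0] -> cword (F2 G) = [:: 0; 0] ->
  clab (F1 G) 0 <> clab (F2 G) 0 -> ~ same_map F1 F2.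
Proof.
move=> w1 w2 ne /(_ G) [f []]; rewrite w1 w2 => _ [f0 _] H; apply: ne.
(* Both words being [[:: 0; 0]], the renaming must fix the only chord. *)
by rewrite -(H 0) ?mem_head // -f0.
Qed.

Lemma same_map_clab (F1 F2 : gauss -> cdiag sign) :
  (forall G, cword (F1 G) = cword (F2 G)) ->
  (forall G, clab (F1 G) =1 clab (F2 G)) -> same_map F1 F2.
Proof.
by move=> cw cl G; exists id; split=> [//||c _]; rewrite ?map_id ?cw ?cl.
Qed.

(** The maps [p_r], [p_ra], [i o p], [i_a o p] give a positive chord the signs +, -, +, - if it is
    forward and +, -, -, + if it is backward, so any two of them differ on one of these diagrams. *)
Definition G_forward := Gauss (fun=> Plus) forward_chord_wf.
Definition G_backward := Gauss (fun=> Plus) backward_chord_wf.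

Definition interlaced : word := [:: (0, true); (1, false); (0, false); (1, true)].
Definition interlaced_R2 : word := [:: (0, true); (1, true); (0, false); (1, false)].
Definition interlaced_sign (c : nat) : sign := if c is 0 then Plus else Minus.
Lemma interlaced_wf : gauss_wf interlaced. Proof. by []. Qed.
Lemma interlaced_R2_wf : gauss_wf interlaced_R2. Proof. by []. Qed.
Lemma nil_wf : gauss_wf [::]. Proof. by []. Qed.

Definition hidden_trefoil := Gauss interlaced_sign interlaced_wf.
Definition trivial_knot := Gauss interlaced_sign nil_wf.

(** Reversing the arrow of chord 1 turns [interlaced] into [interlaced_R2], which a second move
    creates from the empty word. *)
Lemma jones_hidden_trefoil : jones hidden_trefoil = jones trivial_knot.
Proof.
rewrite !jones_kjones /= (word_jones_arrows interlaced_sign interlaced_wf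
  interlaced_R2_wf) //.
have := @kjones_R2 _ kauffA kauffA_neq0 loopv_neq0 interlaced_sign [::] [::] [::] 0 1
  true true isT isT.
by move=> <-.
Qed.

Section VirtualTrefoil.
Local Open Scope ring_scope.

Lemma word_jones_nil e : word_jones e ([::] : word) = 1.
Proof.
by rewrite /kjones /= big_nil oppr0 expr0z expr0 !mul1r invr1.
Qed.

Lemma kjones_trefoil (F : fieldType) (x : F) : x != 0 -> loopv x^-1 != 0 ->
  kjones x^-1 (fun=> Plus) [:: 0; 1]%N interlaced = x ^+ 4 + x ^+ 6 - x ^+ 10.
Proof.
move=> x0 l0; rewrite /kjones !big_cons big_nil.
rewrite [bracket _ _ _ _]/=.
repeat match goal with |- context [grank ?E] =>
  let n := eval vm_compute in (grank E) in
  rewrite (_ : grank E = n); last by vm_compute end.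
rewrite (_ : - _ = - 2%:Z) // -exprnN [(2 * size interlaced)%N]/=.
have : loopv x^-1 = - x ^- 2 - x ^+ 2 by rewrite /loopv exprVn invrK; field.
move: (loopv x^-1) l0 => d d0 dx.
(* The prefactor is the writhe factor for two positive chords. Only the state with two negative
   markers has two circles, whence the single factor [d]. *)
transitivity (x ^+ 6 * (x ^- 2 + 1 + 1 + x ^+ 2 * d)); first by field;
  rewrite x0 d0 oner_eq0.
by rewrite dx; field.
Qed.

Lemma trefoil_neq1 (x : {poly int}) : x = 'X -> x ^+ 4 + x ^+ 6 - x ^+ 10 <> 1.
Proof.
(* At 2 the left-hand side takes the value 16 + 64 - 1024. *)
by move=> -> /(congr1 (fun p : {poly int} => p.[2%:Z])); rewrite !hornerE.
Qed.

Lemma word_jones_trefoil : word_jones (fun=> Plus) interlaced <> 1.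
Proof.
have X0 : tofrac ('X : {poly int}) != 0 by rewrite tofrac_eq0 polyX_eq0.
rewrite [undup _]/= (kjones_trefoil X0 loopv_neq0).
rewrite -!tofracXn -tofracD -tofracB -tofrac1 => /eqP.
rewrite tofrac_eq => /eqP; exact: trefoil_neq1.
Qed.

End VirtualTrefoil.

Theorem theorem3p4 :
  [/\ same_map (fun D => map_i (map_p D)) (fun D => map_ia (map_pa D)) /\
      same_map (fun D => map_ia (map_p D)) (fun D => map_i (map_pa D)),

      [/\ ~ same_map map_pr map_pra,
          ~ same_map map_pr (fun D => map_i (map_p D)) &
          ~ same_map map_pr (fun D => map_ia (map_p D))] /\
      [/\ ~ same_map map_pra (fun D => map_i (map_p D)),
          ~ same_map map_pra (fun D => map_ia (map_p D)) &
          ~ same_map (fun D => map_i (map_p D)) (fun D => map_ia (map_p D))],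

      [/\ long_invariant (fun D => jones_cd (map_pr D)),
          long_invariant (fun D => jones_cd (map_pra D)),
          long_invariant (fun D => jones_cd (map_i (map_p D))) &
          long_invariant (fun D => jones_cd (map_ia (map_p D)))] &

      (forall D1 D2 : gauss, four_jones D1 = four_jones D2 ->
         jones D1 = jones D2) /\
      (exists D1 D2 : gauss, jones D1 = jones D2 /\
         four_jones D1 <> four_jones D2)].
Proof.
split.
- split; apply: same_map_clab => // G c /=; by case: (ab_of _ _).
- by split; split; first [by apply: (@not_same_map _ _ G_forward) | by apply:
  (@not_same_map _ _ G_backward)].
- have id1 : @id sign =1 id \/ @id sign =1 tau1 by left.
  have tau2 : tau1 =1 id \/ tau1 =1 tau1 by right.
  split=> D D' DD'.
  + have E G : jones_cd (map_pr G) = word_jones (id \o gsign G) (gword G) by exact: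
    jones_cd_word.
    by rewrite !E (lvk_word_jones id1 DD').1.
  + have E G : jones_cd (map_pra G) = word_jones (tau1 \o gsign G) (gword G) by
    exact: jones_cd_word.
    by rewrite !E (lvk_word_jones tau2 DD').1.
  + by rewrite !jones_cd_ip; apply: (lvk_word_jones id1 DD').2.
  + have E G : jones_cd (map_ia (map_p G)) = word_jones (tau1 \o ip_sign (gsign G)
    (gword G)) (gword G).
      exact/jones_cd_word/clab_iap.
    by rewrite !E (lvk_word_jones tau2 DD').2.
split.
  (* The first of the four polynomials is the Jones polynomial itself. *)
  by move=> D1 D2 [H _ _ _]; rewrite !(jones_choice (erefl _)).
exists hidden_trefoil, trivial_knot; split; first exact: jones_hidden_trefoil.
case=> _ _ H _; apply: word_jones_trefoil; rewrite -(word_jones_nil (ip_sign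
  interlaced_sign [::])).
have := jones_cd_ip trivial_knot; rewrite -H jones_cd_ip /= => <-.
(* Chord 0 is positive and forward, chord 1 negative and backward, so [ip_sign] is [Plus] on
   both. *)
by apply: kjones_ext => c; rewrite !inE => /orP[] /eqP ->.
Qed.
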